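(* Let $\gamma$ be a fixed irrational number of finite type $\tau<\infty$. Then for every real number $\varepsilon$ with $0<\varepsilon<1/(8\tau)$ there is a number $\eta>0$ such that the bound $$\left|\sum_{\substack{m\leqslant M\\ m\equiv a \pmod q}}\Lambda(m)\,\mathbf{e}(\gamma k m)\right|\leqslant M^{1-\eta}$$ holds for all integers $k,a,q$ with $1\leqslant k\leqslant M^{\varepsilon}$, $0\leqslant a<q\leqslant M^{\varepsilon/4}$ and $\gcd(a,q)=1$, provided that $M$ is sufficiently large (in terms of $\gamma$ and $\varepsilon$ only, uniformly in $k,a,q$).
   Context: For a real $x$, $\|x\|$ denotes the distance from $x$ to the nearest integer. The type of an irrational number $\gamma$ is $\tau=\sup\{\varrho\in\mathbb{R} : \liminf_{n\to\infty,\,n\in\mathbb{N}} n^{\varrho}\|\gamma n\|=0\}$; $\gamma$ is of finite type if $\tau<\infty$. $\mathbf{e}(x)=e^{2\pi i x}$, and $\Lambda$ is the von Mangoldt function: $\Lambda(n)=\log p$ if $n$ is a power of a prime $p$, and $\Lambda(n)=0$ otherwise. Sums over $m\leqslant M$ range over positive integers $m$. *)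

(* Defs.v *)
From mathcomp Require Import all_boot all_order all_algebra.
From mathcomp Require Import complex.
From mathcomp Require Import all_classical all_reals all_analysis.

Set Implicit Arguments.
Unset Strict Implicit.
Unset Printing Implicit Defensive.

Import Order.TTheory GRing.Theory Num.Theory.

Local Open Scope classical_set_scope.
Local Open Scope ring_scope.

Definition dist_int (R : realType) (x : R) : R :=
  inf [set `|x - z%:~R| | z in [set: int]].

(* The supremum is taken in the extended reals, so that infinite type is the
   value +oo. The term n = 0 of the sequence does not affect the liminf. *)
Definition irrational_type (R : realType) (gamma : R) : \bar R :=
  ereal_sup [set rho%:E | rho in
    [set rho : R |
      limn_einf (fun n : nat => (n%:R `^ rho * dist_int (gamma * n%:R))%:E)
      = 0%E]].

(* e^(2 pi i x), written with Euler's formula *)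
Definition cexp2pi (R : realType) (x : R) : R[i] :=
  (cos (2 * pi * x) +i* sin (2 * pi * x))%C.

(* [primes n] is the singleton [:: p] exactly when n = p ^ j with p prime and
   j >= 1; see the two lemmas below. *)
Definition von_mangoldt (R : realType) (n : nat) : R :=
  if primes n is [:: p] then ln p%:R else 0.

Lemma von_mangoldt_pfactor (R : realType) (p j : nat) :
  prime p -> von_mangoldt R (p ^ j.+1) = ln p%:R.
Proof. by move=> pp; rewrite /von_mangoldt primesX// primes_prime. Qed.

Lemma von_mangoldt_eq0 (R : realType) (n : nat) :
  (forall p j : nat, prime p -> n <> (p ^ j.+1)%N) -> von_mangoldt R n = 0.
Proof.
rewrite /von_mangoldt => npp; case E : (primes n) => [//|p [|//]].
have : p \in primes n by rewrite E mem_head.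
rewrite mem_primes => /and3P[pp n0 pn].
have lp : (0 < logn p n)%N by rewrite logn_gt0 E mem_head.
case: (npp p (logn p n).-1 pp); rewrite (prednK lp) -p_part part_pnat_id//.
apply/pnatP => // r rp rn.
have : r \in primes n by rewrite mem_primes rp n0.
by rewrite E inE => /eqP ->; rewrite inE.
Qed.

(* Main.v *)
Require Import Defs.
From mathcomp Require Import all_boot all_order all_algebra.
From mathcomp Require Import complex.
From mathcomp Require Import all_classical all_reals all_analysis.
From mathcomp Require Import zify ring lra.

(* Additive characters modulo q remove the congruence condition, so it suffices
   to bound the sum of Lambda(n) e(alpha n) over n <= M for
   alpha = gamma k + b / q.  The finite type of gamma and eps < 1 / (8 tau)
   keep alpha n at distance at least M^(-1/4) from the integers for all
   n <= M^delta, with a small delta > 0.  Hence the l for which alpha l is close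
   to an integer are M^delta-spaced, and every other l gives a geometric sum of
   size O(M^(1/4)).  This dichotomy replaces rational approximations to alpha:
   it bounds the Type I sums of Vaughan's identity with U = V = Y ~ M^(1/3)
   directly, and its Type II sums after splitting the outer variable into blocks
   of length Y, Cauchy-Schwarz, and the mean square of the divisor function. *)

Set Implicit Arguments.
Unset Strict Implicit.
Unset Printing Implicit Defensive.

Import Order.TTheory GRing.Theory Num.Theory.
Import ComplexField.Normc.

Local Open Scope classical_set_scope.
Local Open Scope ring_scope.

(** * Exponentials and distance to the integers *)

(** How the exponents fit together: with sigma = M^(-s) and Y = M^y, the Type I sums run over moduli
    up to Y^2 and cost about Y^2 / sigma, while the Type II saving contains 1 / (Y sigma). A power
    saving needs 2 y + s < 1 and s < y, and y = 1/3 permits every s < 1/3. The value s = 1/4 is what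
    the hypothesis on eps delivers. Multiplying alpha n by q removes b / q modulo 1, so the distance
    of alpha n from the integers is at least of order (k n q)^(-rho) / q for any rho > tau. The
    total exponent rho (5 eps / 4 + delta) + eps / 4 stays below 1/4 once rho eps < 1/8 and eps <
    1/4; the last inequality comes from tau >= 1/2, a consequence of Dirichlet's approximation
    theorem. The frequency alpha changes with k, b and q, and the bound has to be uniform in them.
    The only information on alpha that enters is the lower bound on the short range n <= M^delta, so
    uniformity is automatic. *)

Section ComplexExponential.
Variable R : realType.
Implicit Types (x y : R) (z : R[i]).

Lemma normc_ge0 z : 0 <= normc z.
Proof. by case: z => a b; exact: sqrtr_ge0. Qed.

Lemma normE z : `|z| = (normc z)%:C%C.
Proof. by rewrite normc_def; case: z. Qed.

Lemma normc_real x : normc x%:C%C = `|x|.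
Proof. by rewrite /= expr0n addr0 sqrtr_sqr. Qed.

Lemma normc_sum (I : Type) (r : seq I) (P : pred I) (F : I -> R[i]) :
  normc (\sum_(i <- r | P i) F i) <= \sum_(i <- r | P i) normc (F i).
Proof.
elim/big_ind2: _ => [|a b c d h1 h2|//]; first by rewrite normc0.
by apply: le_trans (le_normcD _ _) _; exact: lerD.
Qed.

Lemma normc_conj z : (normc z ^+ 2)%:C%C = z * z^*%C.
Proof.
case: z => a b; rewrite /= sqr_sqrtr ?addr_ge0 ?sqr_ge0 //.
by rewrite /real_complex_def; congr Complex; ring.
Qed.

Lemma cexp2piD x y : cexp2pi (x + y) = cexp2pi x * cexp2pi y.
Proof.
rewrite /cexp2pi mulrDr cosD sinD.
by congr Complex; rewrite addrC.
Qed.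

Lemma cexp2pi0 : cexp2pi (0 : R) = 1.
Proof. by rewrite /cexp2pi mulr0 cos0 sin0. Qed.

Lemma normc_cexp2pi x : normc (cexp2pi x) = 1.
Proof. by rewrite /= cos2Dsin2 sqrtr1. Qed.

Lemma cexp2piN x : cexp2pi (- x) = ((cexp2pi x)^*)%C.
Proof. by rewrite /cexp2pi mulrN cosN sinN. Qed.

Lemma cexp2pi_mulrn x n : cexp2pi (x *+ n) = cexp2pi x ^+ n.
Proof.
elim: n => [|n IH]; first by rewrite mulr0n cexp2pi0.
by rewrite mulrS cexp2piD IH exprS.
Qed.

Lemma cexp2pi_nat n : cexp2pi (n%:R : R) = 1.
Proof.
rewrite cexp2pi_mulrn (_ : cexp2pi 1 = 1) ?expr1n //.
by rewrite /cexp2pi mulr1 mulrC mulr_natr cos2pi sin2pi.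
Qed.

Lemma cexp2pi_int (m : int) : cexp2pi (m%:~R : R) = 1.
Proof.
case: m => n; first exact: cexp2pi_nat.
by rewrite NegzE mulrNz cexp2piN cexp2pi_nat conjc1.
Qed.

(* chord x = 2 |sin (pi x)| is a subadditive substitute for the distance of x
   to the nearest integer. *)
Definition chord x : R := normc (cexp2pi x - 1).

Lemma chord_ge0 x : 0 <= chord x. Proof. exact: normc_ge0. Qed.

Lemma chord0 : chord 0 = 0.
Proof. by rewrite /chord cexp2pi0 subrr normc0. Qed.

Lemma chordD x y : chord (x + y) <= chord x + chord y.
Proof.
rewrite /chord cexp2piD.
have -> : cexp2pi x * cexp2pi y - 1
  = (cexp2pi x - 1) * cexp2pi y + (cexp2pi y - 1) by ring.
by apply: le_trans (le_normcD _ _) _; rewrite normcM normc_cexp2pi mulr1.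
Qed.

Lemma chordN x : chord (- x) = chord x.
Proof.
rewrite /chord -[RHS]mul1r -(normc_cexp2pi (- x)) -normcM mulrBr mulr1.
by rewrite -cexp2piD addNr cexp2pi0 -normcN opprB.
Qed.

Lemma chord_mulrn x n : chord (x *+ n) <= chord x *+ n.
Proof.
elim: n => [|n IH]; first by rewrite mulr0n chord0.
by rewrite !mulrS; apply: le_trans (chordD _ _) _; exact: lerD.
Qed.

Lemma chordD_int x (m : int) : chord (x + m%:~R) = chord x.
Proof. by rewrite /chord cexp2piD cexp2pi_int mulr1. Qed.

(** Here cos (2 pi x) <= 0, so the square of the chord, 2 - 2 cos (2 pi x), is at least 2. *)
Lemma chord_ge1 x : 4^-1 <= x -> x <= 2^-1 -> 1 <= chord x.
Proof.
move=> x4 x2; rewrite /chord /= -[X in X <= _]sqrtr1 ler_wsqrtr //.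
rewrite subr0.
have pi0 := pi_gt0 R.
have c0 : cos (2 * pi * x) <= 0.
  have -> : 2 * pi * x = (2 * pi * x - pi / 2) + pi / 2 by ring.
  rewrite cosDpihalf oppr_le0 sin_ge0_pi //; nra.
have := cos2Dsin2 (2 * pi * x); nra.
Qed.

(* For y in (0, 1/2] the multiple n y with n = floor (1 / (2 y)) lies in
   [1/4, 1/2], so 1 <= chord (n y) <= n chord y. *)
Lemma le_chord y : 0 <= y -> y <= 2^-1 -> y <= chord y.
Proof.
rewrite le_eqVlt => /orP[/eqP <- _|y0 y2]; first exact: chord_ge0.
set n := Num.truncn (2 * y)^-1.
have n0 : 0 <= (2 * y)^-1 by rewrite invr_ge0; lra.
have /andP[n1 n2] : n%:R <= (2 * y)^-1 < n.+1%:R by rewrite truncn_itv.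
have yy : (2 * y)^-1 * y = 2^-1 by field; lra.
have ny : n%:R * y <= 2^-1 by rewrite -yy ler_pM2r.
have ny4 : 4^-1 <= n%:R * y.
  have h : 2^-1 < n.+1%:R * y by rewrite -yy ltr_pM2r.
  have [y4|y4] := lerP y 4^-1; first by nra.
  have : (1 <= n)%N.
    by rewrite truncn_ge_nat // invf_ge1; lra.
  rewrite -(ler_nat R); nra.
have := chord_mulrn y n; rewrite -mulr_natl -[X in _ <= X]mulr_natl => h.
have h1 := chord_ge1 ny4 ny.
have nc : 1 <= n%:R * chord y by exact: le_trans h1 h.
have c0 := chord_ge0 y.
(* As n <= 1 / (2 y), this product is nonnegative; expanded, it gives 2 y <= 2 y (n chord y) <=
   chord y. *)
have : 0 <= (2 * y) * ((2 * y)^-1 - n%:R) * chord y.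
  by rewrite !mulr_ge0 ?subr_ge0 //; lra.
have -> : 2 * y * ((2 * y)^-1 - n%:R) * chord y
  = chord y - 2 * y * (n%:R * chord y) by field; lra.
nra.
Qed.

Lemma dist_int_le x (m : int) : dist_int x <= `|x - m%:~R|.
Proof.
apply: ge_inf; last by exists m.
by exists 0 => _ [m' _ <-].
Qed.

Lemma dist_int_chord x : dist_int x <= chord x.
Proof.
pose m := Num.floor (x + 2^-1).
have /andP[m1 m2] := floor_itv (x + 2^-1).
apply: le_trans (dist_int_le x m) _.
rewrite -(chordD_int x (- m)) mulrNz.
have h : `|x - m%:~R| <= 2^-1.
  by rewrite ler_norml; move: m1 m2; rewrite -/m intrD; lra.
have [z0|z0] := lerP 0 (x - m%:~R).
  rewrite ger0_norm // in h *. exact: le_chord.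
by rewrite -chordN -(ltr0_norm z0) le_chord.
Qed.

Lemma sum_geometric x i j : (i <= j)%N ->
  (\sum_(i <= n < j) cexp2pi (x * n%:R)) * (cexp2pi x - 1) =
  cexp2pi (x * j%:R) - cexp2pi (x * i%:R).
Proof.
move=> ij; rewrite mulr_suml -(telescope_sumr (fun n => cexp2pi (x * n%:R)) ij).
apply: eq_bigr => n _.
by rewrite mulrBr mulr1 -cexp2piD -[n.+1]addn1 natrD mulrDr mulr1.
Qed.

(** The product form avoids dividing by [chord x], which vanishes at integers. *)
Lemma sum_geometric_bound x i j :
  normc (\sum_(i <= n < j) cexp2pi (x * n%:R)) * chord x <= 2.
Proof.
have [ij|ji] := leqP i j; last first.
  by rewrite big_geq ?normc0 ?mul0r // ltnW.
rewrite -normcM sum_geometric //.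
apply: le_trans (le_normcD _ _) _.
by rewrite normcN !normc_cexp2pi; lra.
Qed.

Lemma sum_cexp2pi_triv x i j :
  normc (\sum_(i <= n < j) cexp2pi (x * n%:R)) <= (j - i)%:R.
Proof.
apply: le_trans (normc_sum _ _ _) _.
rewrite (eq_bigr (fun=> 1)) => [|n _]; last by rewrite normc_cexp2pi.
by rewrite sumr_const_nat.
Qed.

End ComplexExponential.

(** * Divisor sums *)

Section DivisorSums.

Lemma sum_multiples (V : nmodType) (p N : nat) (F : nat -> V) :
  (0 < p)%N ->
  \sum_(1 <= l < N.+1 | (p %| l)%N) F l =
  \sum_(1 <= e < (N %/ p).+1) F (p * e)%N.
Proof.
move=> p0; rewrite -big_filter -(big_map (muln p) predT).
apply: perm_big; apply: uniq_perm.
- by rewrite filter_uniq // iota_uniq.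
- rewrite map_inj_uniq ?iota_uniq // => x y /eqP.
  by rewrite eqn_pmul2l // => /eqP.
- move=> l; rewrite mem_filter mem_index_iota; apply/andP/mapP.
    case=> /dvdnP[e ->{l}] /andP[l1 l2]; exists e; last by rewrite mulnC.
    rewrite mem_index_iota ltnS leq_divRL //.
    by case: e l1 l2 => [|e] l1 l2 //=; rewrite ltnS in l2.
  case=> e; rewrite mem_index_iota ltnS leq_divRL // => /andP[e1 e2] ->.
  by rewrite dvdn_mulr // muln_gt0 p0 e1 ltnS mulnC.
Qed.

Lemma sum_divisors (V : nmodType) (n N : nat) (F : nat -> V) :
  (0 < n)%N -> (n <= N)%N ->
  \sum_(d <- divisors n) F d = \sum_(1 <= d < N.+1 | (d %| n)%N) F d.
Proof.
move=> n0 nN; rewrite -[RHS]big_filter; apply: perm_big; apply: uniq_perm.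
- exact: divisors_uniq.
- by rewrite filter_uniq // iota_uniq.
move=> d; rewrite mem_filter mem_index_iota -dvdn_divisors //.
case dn: (d %| n)%N => //=; rewrite ltnS (dvdn_gt0 n0 dn) /=.
by rewrite (leq_trans (dvdn_leq n0 dn) nN).
Qed.

(** The pairs with d e <= N are grouped by their product on the left and by d on the right. Summed
    Dirichlet convolutions, divisor moments included, all pass through this. *)
Lemma sum_divisors_pairs (V : nmodType) (N : nat) (G : nat -> nat -> V) :
  \sum_(1 <= n < N.+1) \sum_(d <- divisors n) G d (n %/ d)%N =
  \sum_(1 <= d < N.+1) \sum_(1 <= e < (N %/ d).+1) G d e.
Proof.
rewrite [LHS](_ : _ =
  \sum_(1 <= n < N.+1) \sum_(1 <= d < N.+1 | (d %| n)%N) G d (n %/ d)%N).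
  rewrite (exchange_big_dep_nat xpredT) //; apply: eq_big_nat => d /andP[d0 _].
  rewrite sum_multiples //; apply: eq_bigr => e _.
  by rewrite mulKn.
by apply: eq_big_nat => n /andP[n0 nN]; exact: sum_divisors.
Qed.

(** A divisor x of a b is determined by g = gcd (x, a) and x / g; the latter is coprime to a / g and
    therefore divides b. *)
Lemma size_divisorsM a b : (0 < a)%N -> (0 < b)%N ->
  (size (divisors (a * b)) <= size (divisors a) * size (divisors b))%N.
Proof.
move=> a0 b0; pose f x := (gcdn x a, x %/ gcdn x a)%N.
have fK : {in divisors (a * b), cancel f (fun u => u.1 * u.2)%N}.
  by move=> x _; rewrite /f /= mulnC divnK // dvdn_gcdl.
rewrite -(size_map f) -(size_allpairs pair).
apply: uniq_leq_size.
  by rewrite map_inj_in_uniq ?divisors_uniq //; exact: can_in_inj fK.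
move=> _ /mapP[x xab ->]; rewrite -dvdn_divisors ?muln_gt0 ?a0 // in xab.
apply: allpairs_f; rewrite -dvdn_divisors // ?dvdn_gcdr //.
have g0 : (0 < gcdn x a)%N by rewrite gcdn_gt0 a0 orbT.
have co : coprime (x %/ gcdn x a) (a %/ gcdn x a).
  rewrite /coprime -(eqn_pmul2l g0) muln_gcdr muln1.
  by rewrite !(mulnC (gcdn x a)) !divnK ?dvdn_gcdl ?dvdn_gcdr.
rewrite -(Gauss_dvdr _ co) -(dvdn_pmul2l g0) mulnA !(mulnC (gcdn x a)).
by rewrite !divnK ?dvdn_gcdl ?dvdn_gcdr.
Qed.

End DivisorSums.

(** * Moebius and von Mangoldt functions, moments of the divisor function *)

Section ArithmeticFunctions.
Variable R : realType.

Definition moebius (n : nat) : R :=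
  if all (fun p => logn p n == 1%N) (primes n) then (-1) ^+ size (primes n)
  else 0.

Lemma moebius1 : moebius 1 = 1.
Proof. by rewrite /moebius /= expr0. Qed.

Lemma normr_moebius n : `|moebius n| <= 1.
Proof. by rewrite /moebius; case: ifP => _; rewrite ?normr0 ?normrX ?normrN1 ?expr1n. Qed.

Lemma moebius_pmul p e : prime p -> (0 < e)%N ->
  moebius (p * e) = if (p %| e)%N then 0 else - moebius e.
Proof.
move=> pp e0; have p0 := prime_gt0 pp.
have pe : p \in primes (p * e) by rewrite primesM // primes_prime // inE eqxx.
case: ifP => [dpe|/negbT ndpe].
  rewrite /moebius; case: ifP => // /allP /(_ p pe) /eqP.
  rewrite lognM // logn_prime // eqxx => h.
  by move: dpe; rewrite -[X in (X %| _)%N]expn1 pfactor_dvdn //; lia.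
have npe : p \notin primes e by rewrite mem_primes pp e0.
have P : perm_eq (primes (p * e)) (p :: primes e).
  apply: uniq_perm; rewrite ?primes_uniq //= ?npe ?primes_uniq //.
  by move=> x; rewrite primesM // primes_prime // !inE.
rewrite /moebius (perm_all _ P) (perm_size P) /=.
rewrite lognM // logn_prime // eqxx lognE pp e0 (negbTE ndpe) addn0 eqxx /=.
rewrite (@eq_in_all _ _ (fun q => logn q e == 1%N)); last first.
  move=> q qe; rewrite lognM // logn_prime //.
  have [pq|_] := eqVneq q p; last by [].
  by move: qe; rewrite pq (negbTE npe).
by case: ifP => _; rewrite ?oppr0 // exprS mulN1r.
Qed.

(* Divisors d coprime to p = pdiv n cancel against p d. *)
Lemma sum_moebius n : (0 < n)%N ->
  \sum_(d <- divisors n) moebius d = (n == 1%N)%:R.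
Proof.
move=> n0; have [->|n1] := eqVneq n 1%N.
  by rewrite (_ : divisors 1 = [:: 1%N]) // big_seq1 moebius1.
have pp : prime (pdiv n) by rewrite pdiv_prime //; lia.
move: (pdiv n) (pdiv_dvd n) pp => p pn pp; have p0 := prime_gt0 pp.
rewrite (sum_divisors _ n0 (leqnn n)) (bigID (dvdn p)) /=.
rewrite (eq_bigl (fun d => (p %| d)%N && (d %| n)%N)) => [|d]; last by rewrite andbC.
rewrite big_mkcondr /= sum_multiples // -big_mkcond /=.
have -> : \sum_(1 <= e < (n %/ p).+1 | (p * e %| n)%N) moebius (p * e) =
  - \sum_(1 <= e < (n %/ p).+1 | (e %| n)%N && ~~ (p %| e)%N) moebius e.
  rewrite -sumrN big_mkcond [RHS]big_mkcond; apply: eq_big_nat => e /andP[e0 _].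
  rewrite moebius_pmul //.
  have -> : (p * e %| n)%N = (e %| n %/ p)%N.
    by rewrite -[in LHS](divnK pn) mulnC dvdn_pmul2r.
  case pe: (p %| e)%N => /=; first by rewrite andbF if_same.
  rewrite andbT -[in RHS](divnK pn) mulnC Gauss_dvdr //.
  by rewrite coprime_sym prime_coprime // pe.
apply/eqP; rewrite addrC subr_eq0; apply/eqP.
(* A divisor of n coprime to p divides n / p, so the two ranges of summation carry the same
   terms. *)
have lep : ((n %/ p).+1 <= n.+1)%N by rewrite ltnS leq_div.
rewrite (@big_cat_nat _ _ _ (n %/ p).+1) //= [X in _ + X]big1_seq ?addr0 //.
move=> d; rewrite mem_index_iota => /andP[/andP[dn npd] /andP[d1 _]].
have : (d %| n %/ p)%N.
  move: dn; rewrite -[in X in X -> _](divnK pn) mulnC Gauss_dvdr //.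
  by rewrite coprime_sym prime_coprime // npd.
move/dvdn_leq => h; have := h; rewrite divn_gt0 // dvdn_leq // => /(_ isT); lia.
Qed.

(** Induction from n / p to n for a prime p dividing n: among the divisors of n that do not divide n
    / p, the only prime power is the full power of p in n, and it contributes ln p. *)
Lemma sum_von_mangoldt n : (0 < n)%N ->
  \sum_(d <- divisors n) von_mangoldt R d = ln n%:R.
Proof.
elim/ltn_ind: n => n IH n0; have [->|n1] := eqVneq n 1%N.
  by rewrite (_ : divisors 1 = [:: 1%N]) // big_seq1 /= ln1.
have pp : prime (pdiv n) by rewrite pdiv_prime //; lia.
move: (pdiv n) (pdiv_dvd n) pp => p pn pp; have p0 := prime_gt0 pp.
have m0 : (0 < n %/ p)%N by rewrite divn_gt0 // dvdn_leq.
have mn : (n %/ p < n)%N by rewrite ltn_Pdiv // prime_gt1.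
have lm : logn p n = (logn p (n %/ p)).+1.
  by rewrite -[in LHS](divnK pn) lognM // (logn_prime p pp) eqxx addn1.
rewrite (sum_divisors _ n0 (leqnn n)) (bigID (fun d => d %| n %/ p)%N) /=.
rewrite (eq_bigl (fun d => d %| n %/ p)%N); last first.
  move=> d /=; case h: (d %| n %/ p)%N; rewrite ?andbF // andbT.
  by rewrite -(divnK pn) dvdn_mulr.
rewrite -(sum_divisors _ m0 (ltnW mn)) (IH _ mn m0).
rewrite -big_filter (bigD1_seq (p ^ logn p n)%N) /=; first last.
- by rewrite filter_uniq // iota_uniq.
- rewrite mem_filter mem_index_iota expn_gt0 p0 ltnS dvdn_leq ?pfactor_dvdn //.
  by rewrite leqnn lm ltnn.
rewrite big1_seq ?addr0.
  rewrite lm von_mangoldt_pfactor // -lnM ?posrE ?ltr0n //.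
  by rewrite -natrM divnK.
move=> d /andP[dk]; rewrite mem_filter => /andP[/andP[dn dm] _]; apply: von_mangoldt_eq0 => q j qp.
apply/eqP; apply/negP => /eqP E; subst d.
have [qp'|qp'] := eqVneq q p.
  subst q; move: dn dm dk; rewrite !pfactor_dvdn // -ltnNge.
  move=> h1 h2; have -> : j.+1 = logn p n by apply/eqP; rewrite eqn_leq h1 lm.
  by rewrite eqxx.
have := dn; rewrite -[X in (_ %| X)%N](divnK pn) Gauss_dvdl; first by rewrite (negbTE dm).
by rewrite coprimeXl // prime_coprime // dvdn_prime2.
Qed.

Lemma von_mangoldt_ge0 n : 0 <= von_mangoldt R n.
Proof.
rewrite /von_mangoldt; case E : (primes n) => [//|p [|//]].
have : p \in primes n by rewrite E mem_head.
by rewrite mem_primes => /andP[pp _]; rewrite ln_ge0 // ler1n prime_gt0.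
Qed.

Lemma von_mangoldt_le_ln n : (0 < n)%N -> von_mangoldt R n <= ln n%:R.
Proof.
move=> n0; rewrite -sum_von_mangoldt // (bigD1_seq n) ?divisors_uniq //=; last first.
  by rewrite -dvdn_divisors.
by rewrite lerDl sumr_ge0 // => i _; exact: von_mangoldt_ge0.
Qed.

Lemma ler_ln_nat m n : (0 < m)%N -> (m <= n)%N -> ln m%:R <= ln n%:R :> R.
Proof. by move=> m0 mn; rewrite ler_ln ?posrE ?ltr0n ?ler_nat //; lia. Qed.

Definition harmsum (N : nat) : R := \sum_(1 <= n < N.+1) n%:R^-1.

Lemma harmsum_ge0 N : 0 <= harmsum N.
Proof. by rewrite sumr_ge0 // => i _; rewrite invr_ge0. Qed.

Lemma harmsum_le m n : (m <= n)%N -> harmsum m <= harmsum n.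
Proof.
move=> mn; rewrite /harmsum [X in _ <= X](@big_cat_nat _ _ _ m.+1) //=.
by rewrite lerDl sumr_ge0 // => i _; rewrite invr_ge0.
Qed.

Lemma harmsum_ln N : (0 < N)%N -> harmsum N <= 1 + ln N%:R.
Proof.
case: N => // N _; elim: N => [|N IH].
  by rewrite /harmsum big_nat1 invr1 ln1 addr0.
rewrite /harmsum big_nat_recr //=; apply: le_trans (lerD IH (lexx _)) _.
rewrite -addrA lerD2l addrC -lerBrDr -lerN2 opprB.
have h1 : 0 < N.+1%:R :> R by rewrite ltr0n.
have h2 : 0 < N.+2%:R :> R by rewrite ltr0n.
rewrite -ln_div ?posrE //.
(* The increment 1 / (N + 2) is at most ln ((N + 2) / (N + 1)), by ln (1 + x) <= x at x = - 1 / (N +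
   2). *)
have -> : N.+1%:R / N.+2%:R = 1 + - N.+2%:R^-1 :> R.
  have E : N.+2%:R = N.+1%:R + 1 :> R by rewrite natr1.
  rewrite E in h2 *; move: h2; set a := _%:R => h2; field; lra.
apply: le_ln1Dx; rewrite ltrN2 invf_lt1 // ltr1n.
by [].
Qed.

Lemma divn_le N d : (N %/ d)%:R <= N%:R / d%:R :> R.
Proof.
case: d => [|d]; first by rewrite divn0 invr0 mulr0.
by rewrite ler_pdivlMr ?ltr0n // -natrM ler_nat leq_divM.
Qed.

Lemma sum_size_divisors N :
  \sum_(1 <= n < N.+1) (size (divisors n))%:R <= N%:R * harmsum N.
Proof.
rewrite (eq_bigr (fun n => \sum_(d <- divisors n) (1 : R))); last first.
  by move=> n _; rewrite big_const_seq count_predT iter_addr_0.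
rewrite (sum_divisors_pairs N (fun _ _ => 1)) /harmsum mulr_sumr.
apply: ler_sum => d _; rewrite big_const_nat iter_addr_0 subn1.
exact: divn_le.
Qed.

Lemma sum_size_divisors_div N :
  \sum_(1 <= n < N.+1) (size (divisors n))%:R / n%:R <= harmsum N ^+ 2.
Proof.
pose G (d e : nat) : R := (d * e)%:R^-1.
rewrite (eq_big_nat _ _ (F2 := fun n => \sum_(d <- divisors n) G d (n %/ d)%N)); last first.
  move=> n /andP[n0 _]; rewrite (eq_big_seq (fun=> n%:R^-1)).
    by rewrite big_const_seq count_predT iter_addr_0 mulr_natl.
  by move=> d; rewrite -dvdn_divisors // /G => dn; rewrite mulnC divnK.
rewrite sum_divisors_pairs expr2 [X in _ <= X * _]/harmsum mulr_suml.
apply: ler_sum => d _.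
rewrite (eq_bigr (fun e => d%:R^-1 * e%:R^-1)); last first.
  by move=> e _; rewrite /G natrM invfM.
rewrite -mulr_sumr ler_wpM2l ?invr_ge0 //.
exact/harmsum_le/leq_div.
Qed.

(** Submultiplicativity of the divisor count bounds its square at n by its Dirichlet convolution
    with itself; the inner sum then costs one harmonic sum and the outer one two. *)
Lemma sum_size_divisors_sqr N :
  \sum_(1 <= n < N.+1) ((size (divisors n))%:R) ^+ 2 <= N%:R * harmsum N ^+ 3.
Proof.
pose dv n : R := (size (divisors n))%:R.
have le1 : \sum_(1 <= n < N.+1) dv n ^+ 2 <=
  \sum_(1 <= n < N.+1) \sum_(d <- divisors n) dv d * dv (n %/ d)%N.
  apply: ler_sum_nat => n /andP[n0 _].
  have -> : dv n ^+ 2 = \sum_(d <- divisors n) dv n.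
    by rewrite big_const_seq count_predT iter_addr_0 -mulr_natr.
  rewrite big_seq [X in _ <= X]big_seq; apply: ler_sum => d.
  rewrite -dvdn_divisors // => dn; rewrite /dv -natrM ler_nat.
  rewrite -[X in (size (divisors X) <= _)%N](divnK dn) [leqRHS]mulnC.
  have d0 := dvdn_gt0 n0 dn.
  by apply: size_divisorsM; rewrite // divn_gt0 // dvdn_leq.
apply: le_trans le1 _.
rewrite (sum_divisors_pairs N (fun d e => dv d * dv e)).
have -> : N%:R * harmsum N ^+ 3 = harmsum N ^+ 2 * (N%:R * harmsum N) by ring.
apply: le_trans; last first.
  apply: (ler_wpM2r _ (sum_size_divisors_div N)).
  by rewrite mulr_ge0 // harmsum_ge0.
rewrite mulr_suml; apply: ler_sum => d _.
rewrite -mulr_sumr -mulrA ler_wpM2l ?ler0n //.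
apply: le_trans (sum_size_divisors _) _.
rewrite mulrA [d%:R^-1 * _]mulrC.
by apply: ler_pM; rewrite ?ler0n ?harmsum_ge0 ?divn_le //; exact/harmsum_le/leq_div.
Qed.

End ArithmeticFunctions.

(** * Vaughan's identity *)

Section Vaughan.
Variable R : realType.
Local Notation Lambda := (von_mangoldt R).

Definition moebius_upto (U n : nat) : R := if (n <= U)%N then moebius R n else 0.

Definition moebius_rest (U n : nat) : R :=
  \sum_(d <- divisors n) moebius_upto U d - (n == 1%N)%:R.

(** No divisor of n <= U is truncated, so the full Moebius sum appears. This vanishing keeps the
    second variable of the Type II sum above U. *)
Lemma moebius_rest_small U n : (0 < n)%N -> (n <= U)%N -> moebius_rest U n = 0.
Proof.
move=> n0 nU; rewrite /moebius_rest -sum_moebius // -sumrB big_seq big1 // => d.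
rewrite -dvdn_divisors // => /(dvdn_leq n0) dn.
by rewrite /moebius_upto (leq_trans dn nU) subrr.
Qed.

Lemma normr_moebius_upto U n : `|moebius_upto U n| <= 1.
Proof. by rewrite /moebius_upto; case: ifP; rewrite ?normr_moebius ?normr0. Qed.

Lemma normr_moebius_rest U n : (0 < U)%N -> (0 < n)%N ->
  `|moebius_rest U n| <= (size (divisors n))%:R.
Proof.
move=> U0 n0; have [->|n1] := eqVneq n 1%N.
  by rewrite moebius_rest_small // normr0.
rewrite /moebius_rest (negbTE n1) subr0.
apply: le_trans (ler_norm_sum _ _ _) _.
apply: le_trans (ler_sum _ (fun d _ => normr_moebius_upto U d)) _.
by rewrite big_const_seq count_predT iter_addr_0.
Qed.

Lemma exchange_hyperbola (V : nmodType) (N : nat) (G : nat -> nat -> V) :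
  \sum_(1 <= d < N.+1) \sum_(1 <= e < (N %/ d).+1) G d e =
  \sum_(1 <= e < N.+1) \sum_(1 <= d < (N %/ e).+1) G d e.
Proof.
have E (H : nat -> nat -> V) : \sum_(1 <= d < N.+1) \sum_(1 <= e < (N %/ d).+1) H d e =
  \sum_(1 <= d < N.+1) \sum_(1 <= e < N.+1 | (d * e <= N)%N) H d e.
  apply: eq_big_nat => d /andP[d0 _].
  rewrite (@big_nat_widen _ _ _ _ _ N.+1) ?ltnS ?leq_div //.
  by apply: eq_bigl => e; rewrite ltnS leq_divRL // mulnC.
rewrite !E (exchange_big_dep_nat xpredT) //=.
by apply: eq_bigr => e _; apply: eq_bigl => d; rewrite mulnC.
Qed.

Lemma type1_divisor_sum U N m (F : nat -> R[i]) :
  \sum_(1 <= k < (N %/ m).+1)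
     (\sum_(d <- divisors k) moebius_upto U d)%:C%C * F (m * k)%N =
  \sum_(1 <= d < (N %/ m).+1) (moebius_upto U d)%:C%C *
     \sum_(1 <= e < (N %/ m %/ d).+1) F (m * d * e)%N.
Proof.
pose G (d e : nat) := (moebius_upto U d)%:C%C * F (m * d * e)%N.
transitivity (\sum_(1 <= k < (N %/ m).+1)
                 \sum_(d <- divisors k) G d (k %/ d)%N).
  apply: eq_big_nat => k /andP[k0 _].
  rewrite rmorph_sum /= mulr_suml big_seq [RHS]big_seq.
  apply: eq_bigr => d; rewrite -dvdn_divisors // => dk.
  by rewrite /G -mulnA [(d * _)%N]mulnC divnK.
rewrite sum_divisors_pairs; apply: eq_bigr => d _.
by rewrite mulr_sumr.
Qed.

(* Lambda = g * log - Lambda * r, where g is the truncated Moebius function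
   and r = g * 1 - delta, which vanishes up to U. *)
Lemma vaughan_rest U N (F : nat -> R[i]) :
  \sum_(1 <= n < N.+1) (Lambda n)%:C%C * F n =
  \sum_(1 <= d < N.+1) (moebius_upto U d)%:C%C *
     \sum_(1 <= e < (N %/ d).+1) (ln e%:R)%:C%C * F (d * e)%N -
  \sum_(1 <= m < N.+1) (Lambda m)%:C%C *
     \sum_(1 <= k < (N %/ m).+1) (moebius_rest U k)%:C%C * F (m * k)%N.
Proof.
pose T (d m : nat) := (moebius_upto U d)%:C%C * (Lambda m)%:C%C *
   \sum_(1 <= e < (N %/ d %/ m).+1) F (d * m * e)%N.
(* Both sums are reduced to the same triple sum of [T]: A opens ln as the divisor sum of Lambda, B
   opens the definition of r, whose delta term gives back the sum of Lambda. *)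
have A : \sum_(1 <= d < N.+1) (moebius_upto U d)%:C%C *
     \sum_(1 <= e < (N %/ d).+1) (ln e%:R)%:C%C * F (d * e)%N =
  \sum_(1 <= d < N.+1) \sum_(1 <= m < (N %/ d).+1) T d m.
  apply: eq_bigr => d _.
  transitivity ((moebius_upto U d)%:C%C * \sum_(1 <= e < (N %/ d).+1)
      \sum_(m <- divisors e) ((Lambda m)%:C%C * F (d * m * (e %/ m))%N)).
    congr (_ * _); apply: eq_big_nat => e /andP[e0 _].
    rewrite -sum_von_mangoldt // rmorph_sum /= mulr_suml big_seq [RHS]big_seq.
    apply: eq_bigr => m; rewrite -dvdn_divisors // => dm.
    by rewrite -mulnA [(m * _)%N]mulnC divnK.
  rewrite (sum_divisors_pairs _ (fun m k => (Lambda m)%:C%C * F (d * m * k)%N)).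
  rewrite mulr_sumr; apply: eq_bigr => m _.
  by rewrite /T -mulr_sumr mulrA.
have B : \sum_(1 <= m < N.+1) (Lambda m)%:C%C *
     \sum_(1 <= k < (N %/ m).+1) (moebius_rest U k)%:C%C * F (m * k)%N =
  \sum_(1 <= m < N.+1) \sum_(1 <= d < (N %/ m).+1) T d m -
  \sum_(1 <= n < N.+1) (Lambda n)%:C%C * F n.
  rewrite -sumrB; apply: eq_big_nat => m /andP[m0 mN].
  transitivity ((Lambda m)%:C%C * (\sum_(1 <= k < (N %/ m).+1)
     (\sum_(d <- divisors k) moebius_upto U d)%:C%C * F (m * k)%N - F m)).
    congr (_ * _); rewrite /moebius_rest.
    under eq_bigr do rewrite rmorphB mulrBl.
    rewrite sumrB; congr (_ - _).
    rewrite big_ltn ?ltnS ?divn_gt0 // eqxx muln1 rmorph1 mul1r.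
    rewrite big1_seq ?addr0 // => k /andP[_]; rewrite mem_index_iota => /andP[k2 _].
    by rewrite gtn_eqF // rmorph0 mul0r.
  rewrite mulrBr type1_divisor_sum mulr_sumr; congr (_ - _).
  apply: eq_bigr => d _; rewrite /T mulrA [_ * (Lambda m)%:C%C]mulrC divnAC.
  by under eq_bigr do rewrite (mulnC m).
rewrite A B exchange_hyperbola opprB addrC subrK.
by [].
Qed.

(** The last sum of [vaughan_rest] is split at m = V. Below V, r is opened again into a Type I sum
    and a delta term, which is the short sum of Lambda; above V it is left as the Type II sum. *)
Lemma vaughan U V N (F : nat -> R[i]) :
  \sum_(1 <= n < N.+1) (Lambda n)%:C%C * F n =
  \sum_(1 <= d < N.+1) (moebius_upto U d)%:C%C *
     \sum_(1 <= e < (N %/ d).+1) (ln e%:R)%:C%C * F (d * e)%N -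
  \sum_(1 <= m < N.+1 | (m < V)%N) (Lambda m)%:C%C *
     \sum_(1 <= d < (N %/ m).+1) (moebius_upto U d)%:C%C *
       \sum_(1 <= e < (N %/ m %/ d).+1) F (m * d * e)%N +
  \sum_(1 <= m < N.+1 | (m < V)%N) (Lambda m)%:C%C * F m -
  \sum_(1 <= m < N.+1 | ~~ (m < V)%N) (Lambda m)%:C%C *
     \sum_(1 <= k < (N %/ m).+1) (moebius_rest U k)%:C%C * F (m * k)%N.
Proof.
rewrite (vaughan_rest U) [X in _ - X](bigID (fun m => (m < V)%N)) /=.
rewrite [X in _ - (X + _)](_ : _ =
  \sum_(1 <= m < N.+1 | (m < V)%N) (Lambda m)%:C%C *
     \sum_(1 <= d < (N %/ m).+1) (moebius_upto U d)%:C%C *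
       \sum_(1 <= e < (N %/ m %/ d).+1) F (m * d * e)%N -
  \sum_(1 <= m < N.+1 | (m < V)%N) (Lambda m)%:C%C * F m).
  have E (a b c d : R[i]) : a - (b - c + d) = a - b + c - d by ring.
  exact: E.
rewrite -sumrB big_nat_cond [RHS]big_nat_cond.
apply: eq_bigr => m /andP[/andP[m0 mN] _].
rewrite -type1_divisor_sum -mulrBr; congr (_ * _).
rewrite /moebius_rest.
under eq_bigr do rewrite rmorphB mulrBl.
rewrite sumrB; congr (_ - _).
rewrite big_ltn ?ltnS ?divn_gt0 // eqxx muln1 rmorph1 mul1r.
rewrite big1_seq ?addr0 // => k /andP[_]; rewrite mem_index_iota => /andP[k2 _].
by rewrite gtn_eqF // rmorph0 mul0r.
Qed.

End Vaughan.

(** * Cauchy-Schwarz, sums over spaced sets, partial summation *)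

Section RealSums.
Variable R : realType.

Lemma ler_sum_subseq (s t : seq nat) (f : nat -> R) :
  uniq s -> uniq t -> {subset s <= t} -> (forall i, 0 <= f i) ->
  \sum_(i <- s) f i <= \sum_(i <- t) f i.
Proof.
move=> us ut st f0; rewrite [X in _ <= X](bigID (mem s)) /= -[X in _ <= X + _]big_filter.
rewrite (@perm_big _ _ _ _ s [seq i <- t | i \in s]).
  by rewrite lerDl sumr_ge0.
apply: uniq_perm => //; first exact: filter_uniq.
move=> i; rewrite mem_filter; case: (boolP (i \in s)) => // /st ->.
by [].
Qed.

Lemma sqr_sum_le (m n : nat) (t : nat -> R) :
  (\sum_(m <= i < n) t i) ^+ 2 <= (n - m)%:R * \sum_(m <= i < n) t i ^+ 2.
Proof.
have [mn|nm] := leqP m n; last first.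
  by rewrite big_geq ?expr0n ?mulr_ge0 ?sumr_ge0 // => [i _|]; rewrite ?sqr_ge0 // ltnW.
rewrite -(subnKC mn); move: (n - m)%N => k; rewrite addKn {n mn}.
elim: k => [|k IH]; first by rewrite addn0 big_geq // expr0n mul0r.
rewrite addnS !big_nat_recr ?leq_addr //=.
move: IH; set s := \sum_(_ <= _ < _) t _; set q := \sum_(_ <= _ < _) _ ^+ 2.
set u := t _; rewrite -natr1 => IH.
have q0 : 0 <= q by rewrite sumr_ge0 // => i _; exact: sqr_ge0.
have k0 : 0 <= k%:R :> R by [].
have [k00|kp] := eqVneq k 0%N.
  have -> : s = 0 by rewrite /s k00 addn0 big_geq.
  by rewrite k00 !add0r; lra.
have kp' : 0 < k%:R :> R by rewrite ltr0n lt0n.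
(* Multiplied by k, the difference becomes the induction hypothesis times k + 1 plus the square of s
   - k u. *)
rewrite -subr_ge0 -(pmulr_rge0 _ kp').
have -> : k%:R * ((k%:R + 1) * (q + u ^+ 2) - (s + u) ^+ 2) =
  (k%:R + 1) * (k%:R * q - s ^+ 2) + (s - k%:R * u) ^+ 2 by ring.
by rewrite addr_ge0 ?sqr_ge0 // mulr_ge0 ?subr_ge0 // addr_ge0.
Qed.

Section Spaced.
Variables (H : nat) (P : pred nat).
Hypothesis H0 : (0 < H)%N.
Hypothesis spaced : forall m n, P m -> P n -> (m < n)%N -> (H < n - m)%N.

(** Division by H labels a spaced set injectively by integers, which reduces counts and reciprocal
    sums over it to full intervals. *)
Lemma spaced_divn_inj : {in P &, injective (fun n => n %/ H)%N}.
Proof.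
have key m n : P m -> P n -> (m < n)%N -> (m %/ H <> n %/ H)%N.
  move=> Pm Pn mn; have := spaced Pm Pn mn.
  have := divn_eq m H; have := divn_eq n H.
  have := ltn_pmod m H0; have := ltn_pmod n H0.
  by move=> *; nia.
move=> m n Pm Pn /= E; have [mn|nm|//] := ltngtP m n.
  by case: (key m n Pm Pn mn).
by case: (key n m Pn Pm nm).
Qed.

Lemma count_spaced X :
  \sum_(1 <= n < X.+1 | P n) (1 : R) <= (X %/ H).+1%:R.
Proof.
rewrite -big_filter -(big_map (fun n => n %/ H)%N predT (fun=> 1)).
apply: le_trans (ler_sum_subseq (t := index_iota 0 (X %/ H).+1) _ _ _ _) _.
- rewrite map_inj_in_uniq ?filter_uniq ?iota_uniq // => m n.
  rewrite !mem_filter => /andP[Pm _] /andP[Pn _].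
  exact: spaced_divn_inj.
- exact: iota_uniq.
- move=> _ /mapP[n + ->]; rewrite mem_filter !mem_index_iota => /andP[_ /andP[_ nX]].
  by rewrite ltnS leq_div2r.
- by [].
by rewrite sumr_const_nat subn0.
Qed.

(** Each 1 / n is at most 1 / H times the reciprocal of the label [n %/ H]. The extra hypothesis
    keeps the labels positive; a label 0 would have inverse 0 and spoil the comparison. *)
Lemma sum_inv_spaced W : (forall n, P n -> (0 < n)%N -> (H < n)%N) ->
  \sum_(1 <= n < W.+1 | P n) n%:R^-1 <= harmsum R W / H%:R.
Proof.
move=> PH.
apply: (@le_trans _ _ (\sum_(1 <= n < W.+1 | P n) (n %/ H)%:R^-1 / H%:R)).
  rewrite big_nat_cond [X in _ <= X]big_nat_cond; apply: ler_sum => n.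
  move=> /andP[/andP[n0 _] Pn]; rewrite -invfM -natrM lef_pV2 ?posrE ?ltr0n //.
    by rewrite ler_nat leq_divM.
  by rewrite muln_gt0 divn_gt0 // H0 andbT ltnW // PH.
rewrite -mulr_suml ler_wpM2r ?invr_ge0 //.
rewrite -big_filter -(big_map (fun n => n %/ H)%N predT (fun n => n%:R^-1)).
apply: ler_sum_subseq.
- rewrite map_inj_in_uniq ?filter_uniq ?iota_uniq // => m n.
  rewrite !mem_filter => /andP[Pm _] /andP[Pn _].
  exact: spaced_divn_inj.
- exact: iota_uniq.
- move=> _ /mapP[n + ->]; rewrite mem_filter !mem_index_iota => /andP[Pn /andP[n0 nX]].
  by rewrite divn_gt0 // (ltnW (PH _ Pn n0)) ltnS (leq_trans (leq_div _ _)).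
- by move=> i; rewrite invr_ge0.
Qed.

End Spaced.

(** Partial summation: ln e is a sum of nonnegative increments over k < e, and exchanging the sums
    leaves tails of z, each at most K; the increments add up to ln X. *)
Lemma ln_weighted_sum X (K : R) (z : nat -> R[i]) :
  (forall i, (0 < i)%N -> normc (\sum_(i <= e < X.+1) z e) <= K) ->
  normc (\sum_(1 <= e < X.+1) (ln e%:R)%:C%C * z e) <= ln X%:R * K.
Proof.
move=> hK; pose dl k : R := ln k.+1%:R - ln k%:R.
have lnE e : (0 < e)%N -> ln e%:R = \sum_(1 <= k < e) dl k.
  by move=> e0; rewrite (telescope_sumr (fun k => ln k%:R)) // ln1 subr0.
have -> : \sum_(1 <= e < X.+1) (ln e%:R)%:C%C * z e =
  \sum_(1 <= k < X) (dl k)%:C%C * \sum_(k.+1 <= e < X.+1) z e.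
  transitivity (\sum_(1 <= e < X.+1) \sum_(1 <= k < X | (k < e)%N) (dl k)%:C%C * z e).
    apply: eq_big_nat => e /andP[e0 eX].
    rewrite lnE // rmorph_sum /= mulr_suml.
    by rewrite [LHS](@big_nat_widen _ _ _ _ _ X).
  rewrite (exchange_big_dep_nat xpredT) //=; apply: eq_big_nat => k /andP[k0 kX].
  rewrite mulr_sumr [RHS](@big_nat_widenl _ _ _ k.+1 1%N) //.
apply: le_trans (normc_sum _ _ _) _.
case: X hK => [|X] hK; first by rewrite big_geq // ln0 ?mul0r.
rewrite lnE // mulr_suml; apply: ler_sum_nat => k /andP[k0 kX].
have dl0 : 0 <= dl k by rewrite subr_ge0 ler_ln_nat.
rewrite normcM normc_real ger0_norm // ler_wpM2l //.
exact: hK.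
Qed.

End RealSums.

(** * Type I and Type II sums *)

Section PrimeExponentialSum.
Variables (R : realType) (alpha sigma : R) (H : nat).
Hypothesis sigma0 : 0 < sigma.
Hypothesis H0 : (0 < H)%N.
Hypothesis alpha_chord : forall n, (0 < n)%N -> (n <= H)%N -> sigma <= chord (alpha * n%:R).
Local Notation Lambda := (von_mangoldt R).
Local Notation ee n := (cexp2pi (alpha * n%:R)).

(** Bounds a geometric sum of at most X terms of frequency x. The threshold sigma / 2 is chosen so
    that the difference of two frequencies below it has chord less than sigma. *)
Definition interval_bound (X : R) (x : R) : R :=
  if chord x < sigma / 2 then X else 4 / sigma.

Lemma interval_bound_ge0 X x : 0 <= X -> 0 <= interval_bound X x.
Proof. by rewrite /interval_bound; case: ifP => // _ _; rewrite divr_ge0 // ltW. Qed.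

Lemma sum_interval_bound X x i j : (j - i)%:R <= X ->
  normc (\sum_(i <= n < j) cexp2pi (x * n%:R)) <= interval_bound X x.
Proof.
move=> ijX; rewrite /interval_bound; case: ltrP => hx.
  exact: le_trans (sum_cexp2pi_triv _ _ _) ijX.
have := sum_geometric_bound x i j; set S := normc _ => hS.
have S0 : 0 <= S by exact: normc_ge0.
rewrite ler_pdivlMr //.
have : S * (sigma / 2) <= S * chord x by rewrite ler_wpM2l.
lra.
Qed.

Lemma interval_bound_split X x :
  0 <= X -> interval_bound X x <= (if chord x < sigma / 2 then X else 0) + 4 / sigma.
Proof.
move=> X0; have h : 0 <= 4 / sigma by rewrite divr_ge0 // ltW.
by rewrite /interval_bound; case: ifP => _; rewrite ?add0r // lerDl.
Qed.

(** The shift x serves both uses: x = 0 for Type I sums and x = alpha k for the rows of Type II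
    sums. *)
Lemma chord_small_spaced (x : R) m n :
  chord (x - alpha * m%:R) < sigma / 2 -> chord (x - alpha * n%:R) < sigma / 2 ->
  (m < n)%N -> (H < n - m)%N.
Proof.
move=> hm hn mn; rewrite ltnNge; apply/negP => nmH.
have mn0 : (0 < n - m)%N by rewrite subn_gt0.
have := alpha_chord mn0 nmH.
have -> : alpha * (n - m)%:R = (x - alpha * m%:R) + - (x - alpha * n%:R).
  by rewrite natrB ?(ltnW mn) //; ring.
have := chordD (x - alpha * m%:R) (- (x - alpha * n%:R)).
by rewrite chordN => h1 h2; lra.
Qed.

Lemma type1_sum N W :
  \sum_(1 <= l < W.+1) interval_bound (N%:R / l%:R) (alpha * l%:R) <=
  N%:R * harmsum R W / H%:R + W%:R * (4 / sigma).
Proof.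
apply: (@le_trans _ _ (\sum_(1 <= l < W.+1)
   ((if chord (alpha * l%:R) < sigma / 2 then N%:R / l%:R else 0) + 4 / sigma))).
  by apply: ler_sum => l _; apply: interval_bound_split; rewrite divr_ge0.
rewrite big_split /= lerD //; last by rewrite sumr_const_nat subSS subn0 -[leLHS]mulr_natl.
rewrite -big_mkcond /= -mulr_sumr -mulrA ler_wpM2l //.
have c0 n : chord (alpha * n%:R) = chord (0 - alpha * n%:R) by rewrite sub0r chordN.
apply: sum_inv_spaced => // [m n|n].
  by rewrite !c0; exact: chord_small_spaced.
move=> /= hn n0; rewrite ltnNge; apply/negP => nH.
by have := alpha_chord n0 nH; move: hn sigma0; set u := chord _; lra.
Qed.

Lemma type2_row Y P (x : R) :
  \sum_(1 <= k < P.+1) interval_bound Y%:R (x - alpha * k%:R) <=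
  Y%:R * (P %/ H).+1%:R + P%:R * (4 / sigma).
Proof.
apply: (@le_trans _ _ (\sum_(1 <= l < P.+1)
   ((if chord (x - alpha * l%:R) < sigma / 2 then Y%:R else 0) + 4 / sigma))).
  by apply: ler_sum => l _; exact: interval_bound_split.
rewrite big_split /= lerD //; last by rewrite sumr_const_nat subSS subn0 -[leLHS]mulr_natl.
rewrite -big_mkcond /=.
rewrite -[X in \sum_(_ <= _ < _ | _) X]mulr1 -mulr_sumr ler_wpM2l //.
apply: count_spaced => // m n hm hn.
exact: (chord_small_spaced hm hn).
Qed.

(* Expanding the square and exchanging sums leaves geometric sums over m with
   frequencies alpha (k - k'). *)
Lemma type2_square N A B P (r : nat -> R) :
  (0 < A)%N -> (N %/ A <= P)%N ->
  \sum_(A <= m < B) normc (\sum_(1 <= k < (N %/ m).+1) (r k)%:C%C * ee (m * k)%N) ^+ 2 <=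
  \sum_(1 <= k < P.+1) r k ^+ 2 *
     \sum_(1 <= k' < P.+1) interval_bound (B - A)%:R (alpha * k%:R - alpha * k'%:R).
Proof.
move=> A0 NAP.
pose c k k' := interval_bound (B - A)%:R (alpha * k%:R - alpha * k'%:R).
have c0 k k' : 0 <= c k k' by exact: interval_bound_ge0.
have cC k k' : c k k' = c k' k.
  by rewrite /c /interval_bound -chordN opprB.
have le1 : \sum_(A <= m < B) normc (\sum_(1 <= k < (N %/ m).+1) (r k)%:C%C * ee (m * k)%N) ^+ 2
   <= \sum_(1 <= k < P.+1) \sum_(1 <= k' < P.+1) `|r k| * `|r k'| * c k k'.
  have E : (\sum_(A <= m < B) normc (\sum_(1 <= k < (N %/ m).+1) (r k)%:C%C * ee (m * k)%N) ^+ 2)%:C%C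
    = \sum_(1 <= k < P.+1) \sum_(1 <= k' < P.+1) (r k)%:C%C * (r k')%:C%C *
       \sum_(A <= m < minn B (minn (N %/ k) (N %/ k')).+1)
          cexp2pi ((alpha * k%:R - alpha * k'%:R) * m%:R).
    (* The conditions m k <= N and m k' <= N become an indicator so that the sums can be exchanged;
       afterwards they only shorten the interval of m. *)
    transitivity (\sum_(A <= m < B) \sum_(1 <= k < P.+1) \sum_(1 <= k' < P.+1)
       if (m <= minn (N %/ k) (N %/ k'))%N then
       (r k)%:C%C * (r k')%:C%C * cexp2pi ((alpha * k%:R - alpha * k'%:R) * m%:R) else 0).
      rewrite rmorph_sum /=; apply: eq_big_nat => m /andP[mA mB].
      have m0 : (0 < m)%N by exact: leq_trans A0 mA.
      have mP : ((N %/ m).+1 <= P.+1)%N.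
        by rewrite ltnS (leq_trans _ NAP) // leq_div2l.
      rewrite normc_conj.
      have -> : ((\sum_(1 <= k < (N %/ m).+1) (r k)%:C%C * ee (m * k)%N)^*)%C =
          \sum_(1 <= k < (N %/ m).+1) (r k)%:C%C * cexp2pi (- (alpha * (m * k)%:R)).
        rewrite (rmorph_sum (@conjc R)); apply: eq_bigr => k _.
        by rewrite cexp2piN -(conjc_real (r k)) -(rmorphM (@conjc R)) conjc_real.
      rewrite mulr_suml [LHS](@big_nat_widen _ _ _ _ _ P.+1) // [LHS]big_mkcond.
      apply: eq_big_nat => k /andP[k0 kP].
      rewrite /= ltnS leq_divRL // mulnC.
      case: ifP => hk; last first.
        rewrite big1_seq // => k' /andP[_]; rewrite mem_index_iota => /andP[k'0 _].
        by rewrite leq_min leq_divRL // hk.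
      rewrite mulr_sumr [LHS](@big_nat_widen _ _ _ _ _ P.+1) // [LHS]big_mkcond.
      apply: eq_big_nat => k' /andP[k'0 k'P].
      rewrite /= ltnS leq_divRL // leq_min !leq_divRL // hk /= mulnC.
      case: ifP => // hk'.
      rewrite mulrACA -cexp2piD !natrM.
      by congr (_ * cexp2pi _); ring.
    rewrite exchange_big /=; apply: eq_bigr => k _.
    rewrite exchange_big /=; apply: eq_bigr => k' _.
    rewrite -big_mkcond mulr_sumr /=.
    rewrite [RHS](@big_nat_widen _ _ _ _ _ B) ?geq_minl //=.
    rewrite big_nat_cond [RHS]big_nat_cond; apply: eq_bigl => m /=.
    move: (minn (N %/ k) _) => a; rewrite leq_min ltnS.
    by case: (A <= m)%N; case: (m < B)%N.
  rewrite -[X in X <= _]ger0_norm; last by rewrite sumr_ge0 // => m _; exact: sqr_ge0.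
  rewrite -normc_real E.
  apply: le_trans (normc_sum _ _ _) _; apply: ler_sum => k _.
  apply: le_trans (normc_sum _ _ _) _; apply: ler_sum => k' _.
  rewrite !normcM !normc_real ler_wpM2l ?mulr_ge0 //.
  apply: sum_interval_bound; rewrite ler_nat; apply: leq_sub2r; exact: geq_minl.
apply: le_trans le1 _.
(* By 2 |a b| <= a^2 + b^2 and the symmetry of the kernel [c], only its row sums matter. *)
have le2 : \sum_(1 <= k < P.+1) \sum_(1 <= k' < P.+1) `|r k| * `|r k'| * c k k' <=
  \sum_(1 <= k < P.+1) \sum_(1 <= k' < P.+1) (r k ^+ 2 * c k k' / 2 + r k' ^+ 2 * c k k' / 2).
  apply: ler_sum => k _; apply: ler_sum => k' _.
  have := c0 k k'; set q := c k k' => q0.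
  rewrite -(real_normK (num_real (r k))) -(real_normK (num_real (r k'))).
  have : 0 <= q * (`|r k| - `|r k'|) ^+ 2 by rewrite mulr_ge0 ?sqr_ge0.
  set a := `|r k|; set b := `|_|; rewrite !expr2; nra.
apply: le_trans le2 _.
under eq_bigr do rewrite big_split /=.
rewrite big_split /= [X in _ + X]exchange_big /= -big_split /=.
apply: ler_sum => k _; rewrite -/(c k) mulr_sumr -big_split /=.
by apply: ler_sum => k' _; rewrite (cC k' k) -/(c k k'); lra.
Qed.

End PrimeExponentialSum.

Lemma sum_blocks (V : nmodType) (Y n : nat) (F : nat -> V) :
  \sum_(Y <= m < n.+1 * Y) F m = \sum_(1 <= j < n.+1) \sum_(j * Y <= m < j.+1 * Y) F m.
Proof.
elim: n => [|n IH]; first by rewrite mul1n !big_geq.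
rewrite big_nat_recr //= -IH [LHS](@big_cat_nat _ _ _ (n.+1 * Y)%N) //.
  by rewrite leq_pmull.
by rewrite leq_mul2r leqnSn orbT.
Qed.

Section PrimeSumBound.
Variables (R : realType) (alpha sigma h : R) (H Y N : nat).
Hypothesis sigma0 : 0 < sigma.
Hypothesis H0 : (0 < H)%N.
Hypothesis alpha_chord : forall n, (0 < n)%N -> (n <= H)%N -> sigma <= chord (alpha * n%:R).
Hypothesis HY : (H <= Y)%N.
Hypothesis YN : (Y ^ 2 <= N)%N.
Hypothesis harmh : harmsum R N <= h.
Hypothesis lnh : ln (2 * N)%:R <= h.
Local Notation Lambda := (von_mangoldt R).
Local Notation ee n := (cexp2pi (alpha * n%:R)).

Let Y0 : (0 < Y)%N. Proof. exact: leq_trans H0 HY. Qed.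
Let YleN : (Y <= N)%N. Proof. by apply: leq_trans YN; rewrite leq_pmull. Qed.
Let h0 : 0 <= h. Proof. exact: le_trans (harmsum_ge0 R N) harmh. Qed.

Lemma ln_nat_bound n : (n <= 2 * N)%N -> ln n%:R <= h.
Proof.
case: n => [|n] nN; first by rewrite ln0.
by apply: le_trans lnh; exact: ler_ln_nat.
Qed.

Lemma von_mangoldt_bound n : (n <= 2 * N)%N -> Lambda n <= h.
Proof.
case: n => [|n] nN; first by rewrite /von_mangoldt.
by apply: le_trans (von_mangoldt_le_ln _ _) _ => //; exact: ln_nat_bound.
Qed.

(** Saving over (P Y)^2 in the squared sum of a block, where P = [N %/ (j * Y)]: h^3 comes from the
    mean square of the divisor function, 2 / H from the pairs k, k' with small chord, and the last
    term from the other geometric sums. *)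
Definition type2_saving : R := h ^+ 3 * (2 / H%:R + 4 / (Y%:R * sigma)).

Lemma type2_block j : (0 < j)%N ->
  normc (\sum_(j * Y <= m < j.+1 * Y) (Lambda m)%:C%C *
     \sum_(1 <= k < (N %/ m).+1) (moebius_rest R Y k)%:C%C * ee (m * k)%N)
  <= h * (N%:R / j%:R) * Num.sqrt type2_saving.
Proof.
move=> j0; pose t m := \sum_(1 <= k < (N %/ m).+1) (moebius_rest R Y k)%:C%C * ee (m * k)%N.
pose P := (N %/ (j * Y))%N.
have jY0 : (0 < j * Y)%N by rewrite muln_gt0 j0.
have mP m : (j * Y <= m)%N -> (N %/ m <= P)%N.
  by move=> hm; apply: leq_div2l.
(* If P <= Y, every k in the block is at most Y, where [moebius_rest] vanishes. *)
have [PY|YP] := leqP P Y.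
  rewrite big1_seq ?normc0; first by rewrite mulr_ge0 ?sqrtr_ge0 ?mulr_ge0 ?divr_ge0.
  move=> m /andP[_]; rewrite mem_index_iota => /andP[hm _].
  rewrite [X in _ * X]big1_seq ?mulr0 // => k /andP[_].
  rewrite mem_index_iota ltnS => /andP[k0 km].
  rewrite moebius_rest_small ?mul0r //.
  exact: leq_trans (leq_trans km (mP _ hm)) PY.
have P0 : (0 < P)%N by exact: leq_trans YP.
have jYN : (j * Y <= N)%N by move: P0; rewrite divn_gt0.
(* The last block may run past N, but by at most Y <= N; hence the bound on ln (2 N) built into
   h. *)
have mN m : (m < j.+1 * Y)%N -> (m <= 2 * N)%N by move=> hm; nia.
have st : normc (\sum_(j * Y <= m < j.+1 * Y) (Lambda m)%:C%C * t m) <=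
   h * \sum_(j * Y <= m < j.+1 * Y) normc (t m).
  apply: le_trans (normc_sum _ _ _) _; rewrite mulr_sumr.
  apply: ler_sum_nat => m /andP[_ hm].
  rewrite normcM normc_real ger0_norm ?von_mangoldt_ge0 // ler_wpM2r ?normc_ge0 //.
  by apply: von_mangoldt_bound; exact: mN.
apply: le_trans st _; rewrite -mulrA ler_wpM2l //.
set S := \sum_(_ <= _ < _) _.
have S0 : 0 <= S by rewrite sumr_ge0 // => i _; exact: normc_ge0.
have PYj : P%:R * Y%:R <= N%:R / j%:R :> R.
  rewrite ler_pdivlMr ?ltr0n // -!natrM ler_nat -mulnA [(Y * j)%N]mulnC.
  exact: leq_divM.
apply: (@le_trans _ _ (P%:R * Y%:R * Num.sqrt type2_saving)); last first.
  by rewrite ler_wpM2r ?sqrtr_ge0.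
have E0 : 0 <= type2_saving.
  by rewrite mulr_ge0 ?exprn_ge0 // addr_ge0 // divr_ge0 // mulr_ge0 // ltW.
rewrite -(@ler_pXn2r _ 2) ?nnegrE ?mulr_ge0 ?sqrtr_ge0 //.
rewrite exprMn (sqr_sqrtr E0).
have BA : (j.+1 * Y - j * Y = Y)%N by rewrite mulSn addnK.
apply: le_trans (sqr_sum_le _ _ _) _; rewrite BA.
pose r2 := \sum_(1 <= k < P.+1) moebius_rest R Y k ^+ 2.
have hr2 : r2 <= P%:R * h ^+ 3.
  apply: (@le_trans _ _ (\sum_(1 <= k < P.+1) (size (divisors k))%:R ^+ 2)).
    apply: ler_sum_nat => k /andP[k0 _].
    rewrite -(real_normK (num_real (moebius_rest _ _ _))).
    by rewrite lerXn2r ?nnegrE ?normr_moebius_rest.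
  apply: le_trans (sum_size_divisors_sqr R P) _; rewrite ler_wpM2l //.
  rewrite lerXn2r ?nnegrE ?harmsum_ge0 //.
  by apply: le_trans harmh; apply/harmsum_le/leq_div.
have h1 : \sum_(j * Y <= m < j.+1 * Y) normc (t m) ^+ 2 <=
   r2 * (2 * Y%:R * P%:R / H%:R + P%:R * (4 / sigma)).
  apply: le_trans (type2_square alpha sigma0 _ _ jY0 (leqnn P)) _.
  rewrite /r2 mulr_suml; apply: ler_sum => k _; rewrite ler_wpM2l ?sqr_ge0 // BA.
  apply: le_trans (type2_row sigma0 H0 alpha_chord _ _ _) _.
  have -> : 2 * Y%:R * P%:R / H%:R = Y%:R * (2 * (P%:R / H%:R)) :> R by ring.
  rewrite lerD2r ler_wpM2l // -natr1.
  (* As H <= Y < P, the extra 1 in the count of spaced points is absorbed by doubling P / H. *)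
  have : 1 <= P%:R / H%:R :> R.
    by rewrite ler_pdivlMr ?ltr0n // mul1r ler_nat (leq_trans HY) // ltnW.
  by have := divn_le R P H; set u := _ / _; lra.
have Yp : 0 < Y%:R :> R by rewrite ltr0n.
have Hp : 0 < H%:R :> R by rewrite ltr0n.
apply: (@le_trans _ _ (Y%:R * (P%:R * h ^+ 3 * (2 * Y%:R * P%:R / H%:R + P%:R * (4 / sigma))))).
  rewrite ler_wpM2l //; apply: le_trans h1 _; rewrite ler_wpM2r //.
  by rewrite addr_ge0 ?mulr_ge0 ?invr_ge0 ?divr_ge0 // ltW.
rewrite /type2_saving le_eqVlt; apply/orP; left; apply/eqP.
by field; rewrite !gt_eqF.
Qed.

Lemma type2_total :
  normc (\sum_(1 <= m < N.+1 | ~~ (m < Y)%N) (Lambda m)%:C%C *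
     \sum_(1 <= k < (N %/ m).+1) (moebius_rest R Y k)%:C%C * ee (m * k)%N)
  <= N%:R * h ^+ 2 * Num.sqrt type2_saving.
Proof.
pose F m := (Lambda m)%:C%C *
  \sum_(1 <= k < (N %/ m).+1) (moebius_rest R Y k)%:C%C * ee (m * k)%N.
(* The range is extended to whole blocks; for m > N the inner sum is empty. The weights 1 / j of the
   blocks then add up to one more factor h. *)
rewrite (_ : \sum_(1 <= m < N.+1 | ~~ (m < Y)%N) _ = \sum_(Y <= m < N.+1 * Y) F m); last first.
  rewrite [RHS](@big_cat_nat _ _ _ N.+1) ?leq_pmulr //= ?(leqW YleN) //.
  rewrite [X in _ = _ + X]big1_seq ?addr0.
    rewrite [RHS](@big_nat_widenl _ _ _ Y 1%N) //.
    by apply: eq_bigl => m; rewrite -leqNgt.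
  move=> m /andP[_]; rewrite mem_index_iota => /andP[Nm _].
  by rewrite /F divn_small // big_geq // mulr0.
rewrite sum_blocks; apply: le_trans (normc_sum _ _ _) _.
apply: (@le_trans _ _ (\sum_(1 <= j < N.+1) h * (N%:R / j%:R) * Num.sqrt type2_saving)).
  by apply: ler_sum_nat => j /andP[j0 _]; exact: type2_block.
rewrite -mulr_suml ler_wpM2r ?sqrtr_ge0 //.
rewrite -mulr_sumr -mulr_sumr expr2 mulrCA ler_wpM2l //.
by rewrite ler_wpM2l.
Qed.

Lemma type1_bound W : (W <= N)%N -> (W <= Y ^ 2)%N ->
  \sum_(1 <= l < W.+1) interval_bound sigma (N%:R / l%:R) (alpha * l%:R) <=
  N%:R * h / H%:R + Y%:R ^+ 2 * (4 / sigma).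
Proof.
move=> WN WY; apply: le_trans (type1_sum sigma0 H0 alpha_chord _ _) _.
apply: lerD.
  rewrite ler_wpM2r ?invr_ge0 // ler_wpM2l //.
  by apply: le_trans harmh; exact: harmsum_le.
by rewrite ler_wpM2r ?divr_ge0 ?(ltW sigma0) // -natrX ler_nat.
Qed.

Lemma type1_log :
  normc (\sum_(1 <= d < N.+1) (moebius_upto R Y d)%:C%C *
     \sum_(1 <= e < (N %/ d).+1) (ln e%:R)%:C%C * ee (d * e)%N)
  <= h * (N%:R * h / H%:R + Y%:R ^+ 2 * (4 / sigma)).
Proof.
apply: (@le_trans _ _ (\sum_(1 <= d < N.+1 | (d < Y.+1)%N)
    h * interval_bound sigma (N%:R / d%:R) (alpha * d%:R))); last first.
  rewrite -(@big_nat_widen _ _ _ _ _ _ predT) ?ltnS // -mulr_sumr ler_wpM2l //.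
  by apply: type1_bound; rewrite // leq_pmull.
apply: le_trans (normc_sum _ _ _) _; rewrite [X in _ <= X]big_mkcond /=.
apply: ler_sum_nat => d /andP[d0 dN]; rewrite normcM normc_real ltnS.
case: ifP => dY; last by rewrite /moebius_upto dY normr0 mul0r.
have K0 : 0 <= interval_bound sigma (N%:R / d%:R) (alpha * d%:R).
  by apply: interval_bound_ge0; rewrite ?divr_ge0.
rewrite -[X in _ <= X]mul1r; apply: ler_pM => //; first exact: normc_ge0.
  exact: normr_moebius_upto.
apply: le_trans (ln_weighted_sum (K := interval_bound sigma (N%:R / d%:R) (alpha * d%:R)) _) _.
  move=> i i0; under eq_bigr do rewrite natrM mulrA.
  apply: sum_interval_bound => //; apply: le_trans (divn_le _ _ _).
  by rewrite ler_nat; lia.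
rewrite ler_wpM2r //; apply: ln_nat_bound.
by apply: leq_trans (leq_div _ _) _; rewrite leq_pmull.
Qed.

(** Collecting l = m d <= Y^2 gives each l a weight at most the sum of Lambda over its divisors,
    that is ln l <= h, so a single Type I sum up to Y^2 remains. *)
Lemma type1_von_mangoldt :
  normc (\sum_(1 <= m < N.+1 | (m < Y)%N) (Lambda m)%:C%C *
     \sum_(1 <= d < (N %/ m).+1) (moebius_upto R Y d)%:C%C *
       \sum_(1 <= e < (N %/ m %/ d).+1) ee (m * d * e)%N)
  <= h * (N%:R * h / H%:R + Y%:R ^+ 2 * (4 / sigma)).
Proof.
pose K l := interval_bound sigma (N%:R / l%:R) (alpha * l%:R).
have K0 l : 0 <= K l by apply: interval_bound_ge0; rewrite ?divr_ge0.
apply: (@le_trans _ _ (\sum_(1 <= l < (Y ^ 2).+1) h * K l)); last first.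
  by rewrite -mulr_sumr ler_wpM2l //; exact: type1_bound.
apply: (@le_trans _ _ (\sum_(1 <= l < (Y ^ 2).+1) \sum_(m <- divisors l)
    Lambda m * K (m * (l %/ m))%N)); last first.
  apply: ler_sum_nat => l /andP[l0]; rewrite ltnS => lY.
  rewrite (eq_big_seq (fun m => Lambda m * K l)); last first.
    by move=> m; rewrite -dvdn_divisors // => ml; rewrite mulnC divnK.
  rewrite -mulr_suml sum_von_mangoldt // ler_wpM2r //; apply: ln_nat_bound.
  by rewrite (leq_trans (leq_trans lY YN)) // leq_pmull.
rewrite (sum_divisors_pairs _ (fun m d => Lambda m * K (m * d)%N)).
have Y2 : (Y <= Y ^ 2)%N by rewrite leq_pmull.
apply: (@le_trans _ _ (\sum_(1 <= m < Y) \sum_(1 <= d < (Y ^ 2 %/ m).+1)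
    Lambda m * K (m * d)%N)); last first.
  rewrite [X in _ <= X](@big_cat_nat _ _ _ Y) //= ?(leqW Y2) // lerDl.
  apply: sumr_ge0 => m _; apply: sumr_ge0 => d _.
  by rewrite mulr_ge0 ?von_mangoldt_ge0.
rewrite -(@big_nat_widen _ _ _ _ _ _ predT) ?(leqW YleN) //.
apply: le_trans (normc_sum _ _ _) _; apply: ler_sum_nat => m /andP[m0 mY].
rewrite normcM normc_real ger0_norm ?von_mangoldt_ge0 // -mulr_sumr.
rewrite ler_wpM2l ?von_mangoldt_ge0 //.
have Ym : (Y <= Y ^ 2 %/ m)%N by rewrite leq_divRL // leq_mul2l (ltnW mY) orbT.
have mN : (Y ^ 2 %/ m <= N %/ m)%N by rewrite leq_div2r.
apply: (@le_trans _ _ (\sum_(1 <= d < (N %/ m).+1 | (d < Y.+1)%N) K (m * d)%N)); last first.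
  rewrite -(@big_nat_widen _ _ _ _ _ _ predT) ?ltnS ?(leq_trans Ym) //.
  by rewrite [X in _ <= X](@big_cat_nat _ _ _ Y.+1) //= lerDl sumr_ge0.
apply: le_trans (normc_sum _ _ _) _; rewrite [X in _ <= X]big_mkcond /=.
apply: ler_sum_nat => d /andP[d0 dN]; rewrite normcM normc_real ltnS.
case: ifP => dY; last by rewrite /moebius_upto dY normr0 mul0r.
rewrite -[X in _ <= X]mul1r; apply: ler_pM => //; first exact: normc_ge0.
  exact: normr_moebius_upto.
under eq_bigr do rewrite natrM mulrA.
apply: sum_interval_bound => //; apply: le_trans (divn_le _ _ _).
by rewrite ler_nat subSS subn0 divnMA.
Qed.

Lemma prime_sum_bound :
  normc (\sum_(1 <= n < N.+1) (Lambda n)%:C%C * ee n) <=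
  Y%:R * h + 2 * (h * (N%:R * h / H%:R + Y%:R ^+ 2 * (4 / sigma))) +
  N%:R * h ^+ 2 * Num.sqrt type2_saving.
Proof.
rewrite (vaughan Y Y).
have small : normc (\sum_(1 <= m < N.+1 | (m < Y)%N) (Lambda m)%:C%C * ee m) <= Y%:R * h.
  rewrite -(@big_nat_widen _ _ _ _ _ _ predT) ?(leqW YleN) //.
  apply: le_trans (normc_sum _ _ _) _.
  apply: (@le_trans _ _ (\sum_(1 <= m < Y) h)).
    apply: ler_sum_nat => m /andP[m0 mY].
    rewrite normcM normc_real normc_cexp2pi mulr1 ger0_norm ?von_mangoldt_ge0 //.
    by apply: von_mangoldt_bound; lia.
  by rewrite sumr_const_nat -[leLHS]mulr_natl ler_wpM2r // ler_nat leq_subr.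
have := type1_log; have := type1_von_mangoldt; have := type2_total.
move: small.
set a := \sum_(_ <= _ < _ | _) _; set b := \sum_(_ <= _ < _ | _) _.
set c := \sum_(_ <= _ < _ | _) _; set d := \sum_(_ <= _ < _) _.
move=> ha hb hc hd.
have := le_normcD (d - c + a) (- b); have := le_normcD (d - c) a.
have := le_normcD d (- c); rewrite !normcN.
by move: ha hb hc hd; lra.
Qed.

End PrimeSumBound.

(** * Progressions and Diophantine approximation *)

Section ArithmeticProgression.
Variable R : realType.

Lemma chord_gt0 (y : R) : 0 < y -> y < 1 -> 0 < chord y.
Proof.
move=> y0 y1; have [y2|y2] := lerP y 2^-1.
  exact: lt_le_trans y0 (le_chord (ltW y0) y2).
have -> : chord y = chord (1 - y).
  by rewrite -(chordN y) -(chordD_int (- y) 1) addrC.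
by apply: (@lt_le_trans _ _ (1 - y)); [lra|apply: le_chord; lra].
Qed.

Lemma sum_additive_characters (q a m : nat) : (0 < q)%N ->
  \sum_(0 <= b < q) cexp2pi ((m%:R - a%:R) / q%:R * b%:R : R) =
  if (m == a %[mod q])%N then q%:R else 0.
Proof.
move=> q0; have qR : 0 < q%:R :> R by rewrite ltr0n.
pose x : R := ((m %% q)%:R - (a %% q)%:R) / q%:R.
pose z : int := (m %/ q)%:Z - (a %/ q)%:Z.
have xE : (m%:R - a%:R) / q%:R = x + z%:~R.
  rewrite {1}(divn_eq m q) {1}(divn_eq a q) !natrD !natrM /x /z.
  by rewrite rmorphB /= -!pmulrn; field; rewrite gt_eqF.
rewrite xE; case: eqP => [E|/eqP ne].
  rewrite (eq_bigr (fun=> 1)) => [|b _]; last first.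
    rewrite /x E subrr mul0r add0r (_ : b%:R = b%:Z%:~R) // -rmorphM /=.
    exact: cexp2pi_int.
  by rewrite sumr_const_nat subn0.
(* Distinct residues differ by less than q, so the frequency is not an integer; its geometric sum
   over a full period is then 0. *)
have c0 : chord (x + z%:~R) != 0.
  rewrite chordD_int gt_eqF //.
  have um := ltn_pmod m q0; have ua := ltn_pmod a q0.
  have [lt|lt|E] := ltngtP (m %% q)%N (a %% q)%N; last by rewrite E eqxx in ne.
    rewrite -chordN /x -mulNr opprB -natrB ?(ltnW lt) //.
    apply: chord_gt0; first by rewrite divr_gt0 // ltr0n subn_gt0.
    by rewrite ltr_pdivrMr // mul1r ltr_nat; lia.
  rewrite /x -natrB ?(ltnW lt) //.
  apply: chord_gt0; first by rewrite divr_gt0 // ltr0n subn_gt0.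
  by rewrite ltr_pdivrMr // mul1r ltr_nat; lia.
have := sum_geometric (x + z%:~R) (leq0n q).
rewrite mulr0 cexp2pi0 -xE (mulfVK (lt0r_neq0 qR)) cexp2piD cexp2piN.
rewrite !cexp2pi_nat conjc1 mulr1 subrr => /eqP; rewrite mulf_eq0.
case/orP => [/eqP //|/eqP h]; move: c0.
by rewrite /chord -xE h normc0 eqxx.
Qed.

(** The q characters enter with weight 1 / q each, so passing to the progression loses nothing in
    B. *)
Lemma sum_progression_bound (q a N : nat) (f : nat -> R[i]) (B : R) : (0 < q)%N ->
  (forall b, (b < q)%N ->
     normc (\sum_(1 <= m < N.+1) f m * cexp2pi (b%:R / q%:R * m%:R)) <= B) ->
  normc (\sum_(1 <= m < N.+1 | (m == a %[mod q])%N) f m) <= B.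
Proof.
move=> q0 hB; have qR : 0 < q%:R :> R by rewrite ltr0n.
have E : (q%:R)%:C%C * \sum_(1 <= m < N.+1 | (m == a %[mod q])%N) f m =
  \sum_(0 <= b < q) cexp2pi (- (a%:R / q%:R * b%:R)) *
     \sum_(1 <= m < N.+1) f m * cexp2pi (b%:R / q%:R * m%:R).
  rewrite mulr_sumr big_mkcond.
  under [RHS]eq_bigr do rewrite mulr_sumr.
  rewrite exchange_big /=; apply: eq_bigr => m _.
  transitivity (f m * \sum_(0 <= b < q) cexp2pi ((m%:R - a%:R) / q%:R * b%:R : R)).
    rewrite sum_additive_characters //; case: ifP => _; last by rewrite mulr0.
    by rewrite mulrC rmorph_nat.
  rewrite mulr_sumr; apply: eq_bigr => b _.
  by rewrite mulrCA -cexp2piD; congr (_ * cexp2pi _); ring.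
have := congr1 (@normc R) E; rewrite normcM normc_real ger0_norm // => E'.
rewrite -(ler_pM2l qR) E'.
apply: le_trans (normc_sum _ _ _) _.
apply: (@le_trans _ _ (\sum_(0 <= b < q) B)).
  by apply: ler_sum_nat => b /andP[_ bq]; rewrite normcM normc_cexp2pi mul1r hB.
by rewrite sumr_const_nat subn0 mulr_natl.
Qed.

End ArithmeticProgression.

(** * Finite type as a uniform lower bound for [chord] *)

Section Diophantine.
Variable R : realType.

Lemma limn_einf_neq0 (u : nat -> R) : (forall n, 0 <= u n) ->
  limn_einf (fun n => (u n)%:E) <> 0%E ->
  exists2 c, 0 < c & exists n0, forall n, (n0 <= n)%N -> c <= u n.
Proof.
move=> u0; apply: contra_notP => hno.
rewrite limn_einf_lim.
suff -> : einfs (fun n => (u n)%:E) = fun=> 0%E by rewrite lim_cst.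
apply/funext => n; rewrite /einfs /=; apply/eqP; rewrite eq_le; apply/andP; split.
  apply/lee_addgt0Pr => e e0; rewrite add0e.
  have [k nk uk] : exists2 k, (n <= k)%N & u k < e.
    apply: contrapT => h; apply: hno; exists e => //; exists n => k nk.
    by rewrite leNgt; apply/negP => uk; apply: h; exists k.
  apply: le_trans (ereal_inf_lbound _) _; first by exists k.
  by rewrite lee_fin ltW.
by apply: le_ereal_inf_tmp => _ [k _ <-]; rewrite lee_fin.
Qed.

Lemma dist_int_ge0 (x : R) : 0 <= dist_int x.
Proof.
apply: lb_le_inf; first by exists `|x - 0%:~R|; exists 0.
by move=> _ [m _ <-].
Qed.

(** Pigeonhole: the fractional parts of x i for the K + 1 indices i <= K fall into K intervals of
    length 1 / K. *)
Lemma dirichlet_approximation (x : R) (K : nat) : (0 < K)%N ->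
  exists2 n, (0 < n <= K)%N & dist_int (x * n%:R) <= K%:R^-1.
Proof.
move=> K0; have KR : 0 < K%:R :> R by rewrite ltr0n.
pose fr (i : nat) : R := x * i%:R - (Num.floor (x * i%:R))%:~R.
have fr0 i : 0 <= fr i by rewrite subr_ge0 ge_floor.
have fr1 i : fr i < 1 by rewrite ltrBlDl; have := floorD1_gt (x * i%:R); rewrite intrD.
have frK i : (Num.truncn (K%:R * fr i) < K)%N.
  rewrite -(ltr_nat R); apply: le_lt_trans (_ : K%:R * fr i < _).
    by rewrite truncn_le mulr_ge0.
  by rewrite -[X in _ < X]mulr1 ltr_pM2l.
pose f (i : 'I_K.+1) : 'I_K := Ordinal (frK i).
have /injectivePn[i [j ij fij]] : ~~ injectiveb f.
  apply/negP => /injectiveP /leq_card; rewrite !card_ord ltnn.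
  by [].
have key (i' j' : 'I_K.+1) : (i' < j')%N -> f i' = f j' ->
    exists2 n, (0 < n <= K)%N & dist_int (x * n%:R) <= K%:R^-1.
  move=> lt [E]; exists (j' - i')%N.
    by have := ltn_ord j'; lia.
  apply: le_trans (dist_int_le _ (Num.floor (x * j'%:R) - Num.floor (x * i'%:R))) _.
  rewrite rmorphB /= natrB ?(ltnW lt) //.
  have -> : x * (j'%:R - i'%:R) -
     ((Num.floor (x * j'%:R))%:~R - (Num.floor (x * i'%:R))%:~R) = fr j' - fr i'.
    by rewrite /fr; ring.
  rewrite -(ler_pM2l KR) mulfV ?gt_eqF // -[X in X * _]ger0_norm // -normrM mulrBr.
  have /andP[a1 a2] := truncn_itv (mulr_ge0 (ltW KR) (fr0 i')).
  have /andP[b1 b2] := truncn_itv (mulr_ge0 (ltW KR) (fr0 j')).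
  move: a1 a2 b1 b2; rewrite E -natr1 => a1 a2 b1 b2.
  by rewrite ler_norml; apply/andP; split; lra.
have [lt|lt|E] := ltngtP i j.
- exact: key lt fij.
- exact: key lt (esym fij).
- by move: ij; rewrite (val_inj E) eqxx.
Qed.

(** This turns eps < 1 / (8 tau) into eps < 1/4. An eventual lower bound c for sqrt n times the
    distance would contradict Dirichlet's theorem for gamma n1: the multiplier n1 > n0 forces the
    denominators n1 n into the eventual range, and c^2 K <= n1 fails for the chosen K. *)
Lemma irrational_type_ge_half (gamma tau : R) :
  irrational_type gamma = tau%:E -> 2^-1 <= tau.
Proof.
move=> ht; rewrite -lee_fin -ht; apply: ereal_sup_ubound; exists 2^-1 => //=.
apply: contrapT => /limn_einf_neq0 [n|c c0 [n0 hn0]].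
  by rewrite mulr_ge0 ?powR_ge0 ?dist_int_ge0.
pose n1 := n0.+1; pose K := (Num.truncn (n1%:R / c ^+ 2)).+1.
have [n /andP[np nK]] := dirichlet_approximation (gamma * n1%:R) (ltn0Sn _ : 0 < K)%N.
rewrite -mulrA -natrM => hd.
have KR : 0 < K%:R :> R by rewrite ltr0n.
have h1 : c <= Num.sqrt (n1 * n)%:R / K%:R.
  apply: le_trans (hn0 (n1 * n)%N _) _.
    by apply: leq_trans (leqnSn n0) _; rewrite -/n1 leq_pmulr.
  by rewrite powR12_sqrt // ler_wpM2l ?sqrtr_ge0.
have h2 : c ^+ 2 * K%:R <= n1%:R.
  have : c ^+ 2 <= (n1 * n)%:R / K%:R ^+ 2.
    rewrite -[X in X / _]sqr_sqrtr // -expr_div_n.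
    by rewrite lerXn2r ?nnegrE ?divr_ge0 ?sqrtr_ge0 // ltW.
  rewrite ler_pdivlMr ?exprn_gt0 // => h.
  rewrite -(ler_pM2r KR) -mulrA -expr2; apply: le_trans h _.
  by rewrite -natrM ler_nat leq_mul2l nK orbT.
have : n1%:R / c ^+ 2 < K%:R.
  by have /andP[] := truncn_itv (divr_ge0 (ler0n R n1) (exprn_ge0 2 (ltW c0))).
by rewrite ltr_pdivrMr ?exprn_gt0 // mulrC ltNge h2.
Qed.

(* Applying the eventual bound to a fixed large multiple of n extends it to all
   n > 0. *)
Lemma irrational_type_chord (gamma tau rho : R) :
  irrational_type gamma = tau%:E -> tau < rho -> 0 <= rho ->
  exists2 c, 0 < c & forall n, (0 < n)%N -> c <= n%:R `^ rho * chord (gamma * n%:R).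
Proof.
move=> ht tr r0.
have : limn_einf (fun n : nat => (n%:R `^ rho * dist_int (gamma * n%:R))%:E) <> 0%E.
  move=> E; have : (rho%:E <= tau%:E)%E by rewrite -ht; apply: ereal_sup_ubound; exists rho.
  by rewrite lee_fin leNgt tr.
move=> /limn_einf_neq0 [n|c c0 [n0 hn0]].
  by rewrite mulr_ge0 ?powR_ge0 ?dist_int_ge0.
pose n1 := n0.+1; have n1R : 0 < n1%:R :> R by rewrite ltr0n.
exists (c / (n1%:R `^ rho * n1%:R)).
  by rewrite divr_gt0 // mulr_gt0 // powR_gt0.
move=> n np; rewrite ler_pdivrMr ?mulr_gt0 ?powR_gt0 //.
apply: le_trans (hn0 (n * n1)%N _) _.
  by apply: leq_trans (leqnSn n0) _; rewrite -/n1 leq_pmull.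
rewrite natrM powRM //.
have -> : n%:R `^ rho * chord (gamma * n%:R) * (n1%:R `^ rho * n1%:R) =
  n%:R `^ rho * n1%:R `^ rho * (chord (gamma * n%:R) * n1%:R) by ring.
rewrite ler_wpM2l ?mulr_ge0 ?powR_ge0 //.
apply: le_trans (dist_int_chord _) _.
by rewrite mulrA mulr_natr [X in _ <= X]mulr_natr; exact: chord_mulrn.
Qed.

End Diophantine.

(** * Choice of parameters and the power saving *)

Section PowerSaving.
Variable R : realType.

Lemma le_powR_of_root (C s M : R) : 0 <= C -> 0 < s -> C `^ s^-1 <= M -> C <= M `^ s.
Proof.
move=> C0 s0 h; rewrite -[X in X <= _](powRr1 C0) -(mulVf (lt0r_neq0 s0)) powRrM.
apply: ge0_ler_powR; rewrite ?nnegrE ?powR_ge0 ?(ltW s0) //.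
exact: le_trans (powR_ge0 _ _) h.
Qed.

(** One factor M^(s/2) absorbs the logarithm up to the constant 2 / s, the other absorbs 1 + 2 / s.
    The threshold is explicit so that it depends on s alone. *)
Lemma ln_le_powR (s M : R) : 0 < s -> 1 <= M -> (1 + 2 / s) `^ (s / 2)^-1 <= M ->
  1 + ln M <= M `^ s.
Proof.
move=> s0 M1 h; have M0 : 0 < M by lra.
have s2 : 0 < s / 2 by lra.
have s2i : 0 < 2 / s by rewrite divr_gt0.
have hC : 1 + 2 / s <= M `^ (s / 2) by apply: le_powR_of_root => //; lra.
have hln : ln M <= 2 / s * M `^ (s / 2).
  have := ln_sublinear (powR_gt0 (s / 2) M0); rewrite ln_powR => /ltW h1.
  have -> : ln M = 2 / s * (s / 2 * ln M) by field; lra.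
  by rewrite ler_wpM2l // ltW.
have -> : M `^ s = M `^ (s / 2) * M `^ (s / 2).
  rewrite -powRD; last by rewrite (gt_eqF M0) implybT.
  by congr (_ `^ _); lra.
move: s2i hC hln; set u := M `^ _; set v := 2 / s => s2i hC hln.
have : 0 <= (u - (1 + v)) * u by rewrite mulr_ge0 //; lra.
nra.
Qed.

(* With w = M^(1/12) and h = M^(delta/16), the choices sigma = w^-3, Y ~ w^4
   and H ~ h^16 make every term of prime_sum_bound at most 17 M / h^4. *)
Lemma prime_sum_power_saving (alpha delta M : R) :
  0 < delta -> delta <= 12^-1 -> 1 <= M ->
  5 <= M `^ (delta / 16) -> 1 + ln M <= M `^ (delta / 16) ->
  (forall n, (0 < n)%N -> n%:R <= M `^ delta -> M `^ (- 4^-1) <= chord (alpha * n%:R)) ->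
  normc (\sum_(1 <= n < (Num.truncn M).+1)
     (von_mangoldt R n)%:C%C * cexp2pi (alpha * n%:R)) <= M `^ (1 - delta / 8).
Proof.
move=> d0 d12 M1 h5 hln hch.
have M0 : 0 < M by lra.
have Mn0 : M != 0 by rewrite gt_eqF.
set h := M `^ (delta / 16) in h5 hln *.
pose w := M `^ 12^-1.
have hp : 0 < h by exact: powR_gt0.
have wp : 0 < w by exact: powR_gt0.
have h16 : M `^ delta = h ^+ 16.
  by rewrite -powR_mulrn ?powR_ge0 // /h /w -powRrM; congr (_ `^ _); lra.
have w12 : M = w ^+ 12.
  by rewrite -powR_mulrn ?powR_ge0 // /w -powRrM mulVf // powRr1 // ltW.
have w3 : M `^ (- 4^-1) = (w ^+ 3)^-1.
  rewrite powRN; congr (_^-1).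
  by rewrite -powR_mulrn ?powR_ge0 // /h /w -powRrM; congr (_ `^ _); lra.
(* This is delta <= 1/12. It yields H <= Y and lets the saving 1 / w of the geometric sums count as
   1 / h^16. *)
have hw : h ^+ 16 <= w by rewrite -h16 ler_powR.
have target : M `^ (1 - delta / 8) = w ^+ 12 / h ^+ 2.
  rewrite powRB ?Mn0 ?implybT // powRr1 ?(ltW M0) // -w12; congr (_ / _).
  by rewrite -powR_mulrn ?powR_ge0 // /h /w -powRrM; congr (_ `^ _); lra.
have h1 : 1 <= h by lra.
have h16_1 : 1 <= h ^+ 16 by rewrite exprn_ege1.
have w1 : 1 <= w by lra.
have w4_1 : 1 <= w ^+ 4 by rewrite exprn_ege1.
set N := Num.truncn M; pose H := Num.truncn (h ^+ 16); pose Y := Num.truncn (w ^+ 4).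
have half (x : R) : 1 <= x -> [/\ (0 < Num.truncn x)%N, (Num.truncn x)%:R <= x &
    x <= 2 * (Num.truncn x)%:R].
  move=> x1; have x0 : 0 <= x by lra.
  have /andP[a b] := truncn_itv x0.
  have t0 : (1 <= Num.truncn x)%N by rewrite truncn_ge_nat.
  split => //; move: b; rewrite -natr1 => b.
  have : 1 <= (Num.truncn x)%:R :> R by rewrite ler1n.
  lra.
have [H0 HU HL] := half _ h16_1; have [Y0 YU YL] := half _ w4_1.
have [N0 NU _] := half _ M1; rewrite -/H -/Y -/N in H0 HU HL Y0 YU YL N0 NU.
have HY : (H <= Y)%N.
  apply: le_truncn; apply: le_trans hw _; rewrite -[X in X <= _]expr1.
  by rewrite ler_weXn2l.
have YN : (Y ^ 2 <= N)%N.
  rewrite truncn_ge_nat ?(ltW M0) // natrX w12.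
  apply: (@le_trans _ _ ((w ^+ 4) ^+ 2)); first by rewrite lerXn2r ?nnegrE // exprn_ge0 // ltW.
  by rewrite -exprM ler_weXn2l.
have lnN : 1 + ln N%:R <= h.
  apply: le_trans hln; rewrite lerD2l ler_ln ?posrE ?ltr0n //.
have harmN : harmsum R N <= h by exact: le_trans (harmsum_ln R N0) lnN.
have ln2N : ln (2 * N)%:R <= h.
  rewrite natrM lnM ?posrE ?ltr0n //.
  have l2 : ln 2 <= 1 :> R.
    by have := @le_ln1Dx R 1; rewrite (_ : 1 + 1 = 2) //; apply; lra.
  lra.
have sg0 : 0 < (w ^+ 3)^-1 by rewrite invr_gt0 exprn_gt0.
have hc n : (0 < n)%N -> (n <= H)%N -> (w ^+ 3)^-1 <= chord (alpha * n%:R).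
  move=> n0 nH; rewrite -w3; apply: hch => //; rewrite h16; apply: le_trans HU.
  by rewrite ler_nat.
apply: le_trans (prime_sum_bound sg0 H0 hc HY YN harmN ln2N) _.
have Hp : 0 < H%:R :> R by rewrite ltr0n.
have Yp : 0 < Y%:R :> R by rewrite ltr0n.
have Hi : H%:R^-1 <= 2 / h ^+ 16.
  rewrite -(ler_pM2r Hp) mulVf ?gt_eqF // mulrAC ler_pdivlMr ?exprn_gt0 // mul1r.
  exact: HL.
have Yi : Y%:R^-1 <= 2 / w ^+ 4.
  rewrite -(ler_pM2r Yp) mulVf ?gt_eqF // mulrAC ler_pdivlMr ?exprn_gt0 // mul1r.
  exact: YL.
pose T := w ^+ 12 / h ^+ 4.
have T0 : 0 <= T by rewrite divr_ge0 ?exprn_ge0 // ltW.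
have h5w : h ^+ 5 <= w by apply: le_trans hw; rewrite ler_weXn2l.
have wle (a : nat) : (a <= 11)%N -> w ^+ a * h <= T.
  move=> a11; rewrite /T ler_pdivlMr ?exprn_gt0 // -mulrA -exprS.
  apply: (@le_trans _ _ (w ^+ 11 * w)); last by rewrite -exprSr.
  by apply: ler_pM; rewrite ?exprn_ge0 ?ler_weXn2l // ltW.
have b1 : Y%:R * h <= T by apply: le_trans (wle 4%N isT); rewrite ler_pM2r.
have b2 : h * (N%:R * h / H%:R) <= 2 * T.
  apply: (@le_trans _ _ (h * (w ^+ 12 * h * (2 / h ^+ 16)))).
    rewrite ler_pM2l //; apply: ler_pM; rewrite ?invr_ge0 ?mulr_ge0 ?(ltW hp) //.
    by rewrite ler_pM2r // -w12.
  have -> : h * (w ^+ 12 * h * (2 / h ^+ 16)) = 2 * T * (h ^+ 10)^-1.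
    by rewrite /T; field; rewrite gt_eqF.
  rewrite -[X in _ <= X]mulr1; apply: ler_wpM2l; first by lra.
  by rewrite invf_le1 ?exprn_gt0 // exprn_ege1.
have b3 : h * (Y%:R ^+ 2 * (4 / (w ^+ 3)^-1)) <= 4 * T.
  apply: (@le_trans _ _ (4 * (w ^+ 11 * h))); last by rewrite ler_wpM2l // wle.
  have -> : 4 * (w ^+ 11 * h) = h * ((w ^+ 4) ^+ 2 * (4 / (w ^+ 3)^-1)).
    by field; rewrite gt_eqF.
  rewrite ler_pM2l // ler_wpM2r ?divr_ge0 ?(ltW sg0) //.
  by rewrite lerXn2r ?nnegrE // exprn_ge0 // ltW.
(* The sum is 12 / h^13; it is relaxed to a perfect square, with root 4 / h^6. *)
have sv : type2_saving (w ^+ 3)^-1 h H Y <= 16 / h ^+ 12.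
  apply: (@le_trans _ _ (h ^+ 3 * (2 * (2 / h ^+ 16) + 4 * (2 / h ^+ 16)))).
    rewrite ler_pM2l ?exprn_gt0 // lerD // ?ler_pM2l //.
    rewrite invfM invrK.
    apply: (@le_trans _ _ (2 / w ^+ 4 * w ^+ 3)).
      by rewrite ler_pM2r ?exprn_gt0.
    have -> : 2 / w ^+ 4 * w ^+ 3 = 2 / w by field; rewrite gt_eqF.
    by rewrite ler_pM2l // lef_pV2 ?posrE ?exprn_gt0.
  have -> : h ^+ 3 * (2 * (2 / h ^+ 16) + 4 * (2 / h ^+ 16)) = (12 / h ^+ 12) / h.
    by field; rewrite gt_eqF.
  apply: (@le_trans _ _ (12 / h ^+ 12)).
    rewrite -[X in _ <= X]mulr1 ler_wpM2l ?invf_le1 ?divr_ge0 ?exprn_ge0 //; lra.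
  by rewrite ler_wpM2r ?invr_ge0 ?exprn_ge0 //; lra.
have b4 : N%:R * h ^+ 2 * Num.sqrt (type2_saving (w ^+ 3)^-1 h H Y) <= 4 * T.
  have s4 : Num.sqrt (type2_saving (w ^+ 3)^-1 h H Y) <= 4 / h ^+ 6.
    apply: le_trans (ler_wsqrtr sv) _.
    have -> : 16 / h ^+ 12 = (4 / h ^+ 6) ^+ 2 by field; rewrite gt_eqF.
    by rewrite sqrtr_sqr ger0_norm // divr_ge0 ?exprn_ge0 // ltW.
  apply: (@le_trans _ _ (w ^+ 12 * h ^+ 2 * (4 / h ^+ 6))).
    apply: ler_pM; rewrite ?sqrtr_ge0 ?mulr_ge0 ?exprn_ge0 ?(ltW hp) //.
    by rewrite ler_pM2r ?exprn_gt0 // -w12.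
  rewrite le_eqVlt /T; apply/orP; left; apply/eqP.
  by field; rewrite gt_eqF.
(* 17 = 1 + 2 (2 + 4) + 4, from b1 to b4; the factor h^2 >= 25 between T and the target absorbs
   it. *)
apply: (@le_trans _ _ (17 * T)).
  by rewrite mulrDr; move: b1 b2 b3 b4; lra.
rewrite target /T.
have -> : w ^+ 12 / h ^+ 2 = h ^+ 2 * (w ^+ 12 / h ^+ 4) by field; rewrite gt_eqF.
rewrite ler_wpM2r // expr2; nra.
Qed.

End PowerSaving.

Theorem theorem4p2 (R : realType) (gamma tau : R) :
  irrational gamma ->
  irrational_type gamma = tau%:E ->
  forall eps : R, 0 < eps -> eps < 1 / (8 * tau) ->
  exists eta : R, 0 < eta /\
  exists M0 : R, forall M : R, M0 <= M ->
  forall k a q : nat,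
    (1 <= k)%N -> k%:R <= M `^ eps ->
    (a < q)%N -> q%:R <= M `^ (eps / 4) ->
    coprime a q ->
    `| \sum_(1 <= m < (Num.truncn M).+1 | m == a %[mod q])
         (von_mangoldt R m)%:C%C * cexp2pi (gamma * k%:R * m%:R) |
    <= (M `^ (1 - eta))%:C%C.
Proof.
move=> _ ht eps e0; have tau2 := irrational_type_ge_half ht.
rewrite ltr_pdivlMr; last by lra.
move=> et.
(* The midpoint of tau and 1 / (8 eps): above tau, with rho eps still below 1/8. *)
pose rho := (tau + (8 * eps)^-1) / 2.
have e8 : (8 * eps)^-1 * eps = 8^-1 by field; rewrite gt_eqF.
have tr : tau < rho.
  have : tau < (8 * eps)^-1 by rewrite -(ltr_pM2r e0) e8; lra.
  rewrite /rho; lra.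
have re : rho * eps < 8^-1 by rewrite /rho; lra.
have e4 : eps < 4^-1 by nra.
have [|c c0 hc] := irrational_type_chord ht tr; first by lra.
clear ht.
(* Makes both delta and rho delta at most 1/64. *)
pose delta := (64 * (rho + 1))^-1.
have d0 : 0 < delta by rewrite invr_gt0; lra.
have dE : delta * (rho + 1) = 64^-1 by rewrite /delta invfM mulfVK // gt_eqF //; lra.
have d64 : delta <= 64^-1 by nra.
have rd : rho * delta <= 64^-1 by nra.
have s0 : 0 < delta / 16 by lra.
have s2 : 0 < 2 / (delta / 16) by rewrite divr_gt0.
exists (delta / 8); split; first by lra.
pose M1 : R := 5 `^ (delta / 16)^-1.
pose M2 : R := (1 + 2 / (delta / 16)) `^ (delta / 16 / 2)^-1.
pose M3 : R := c^-1 `^ (64^-1)^-1.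
(* In turn these ensure M >= 1, 5 <= M^(delta/16), the bound on 1 + ln M, and 1 / c <= M^(1/64);
   none involves k, a or q. *)
exists (1 + M1 + M2 + M3) => M hM k a q k0 kM aq qM _.
have p1 : 0 <= M1 by exact: powR_ge0.
have p2 : 0 <= M2 by exact: powR_ge0.
have p3 : 0 <= M3 by exact: powR_ge0.
have M1' : 1 <= M by lra.
have Mp : 0 < M by lra.
have PD (x y : R) : M `^ (x + y) = M `^ x * M `^ y.
  by rewrite powRD // (gt_eqF Mp) implybT.
have q0 : (0 < q)%N by exact: leq_ltn_trans aq.
rewrite normE lecR.
apply: sum_progression_bound => // b bq.
under eq_bigr do rewrite -mulrA -cexp2piD -mulrDl.
apply: prime_sum_power_saving => //; first by lra.
- by apply: le_powR_of_root => //; rewrite -/M1; lra.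
- by apply: ln_le_powR => //; rewrite -/M2; lra.
move=> n n0 nM.
have qR : 0 < q%:R :> R by rewrite ltr0n.
set u := chord _.
have u0 : 0 <= u by exact: chord_ge0.
(* Multiplication by q turns the rational part b n / q into the integer b n, leaving a multiple of
   gamma. *)
have hq : chord (gamma * (k * n * q)%:R) <= q%:R * u.
  have -> : chord (gamma * (k * n * q)%:R) =
      chord (((gamma * k%:R + b%:R / q%:R) * n%:R) *+ q).
    rewrite -(chordD_int _ (b * n)%N) -mulr_natr !natrM.
    rewrite -pmulrn natrM.
    by congr chord; field; rewrite gt_eqF.
  by rewrite [leRHS]mulr_natl; exact: chord_mulrn.
have knq : (0 < k * n * q)%N by rewrite !muln_gt0 k0 n0 q0.
have hknq : (k * n * q)%:R <= M `^ (eps + delta + eps / 4).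
  by rewrite !natrM !PD; do 2! [apply: ler_pM => //].
have rho0 : 0 <= rho by lra.
have c_le : c <= M `^ (15 / 64) * u.
  apply: le_trans (hc _ knq) _.
  apply: (@le_trans _ _ ((M `^ (eps + delta + eps / 4)) `^ rho * (M `^ (eps / 4) * u))).
    apply: ler_pM; rewrite ?powR_ge0 ?chord_ge0 //.
      by apply: ge0_ler_powR; rewrite ?nnegrE ?powR_ge0.
    by apply: le_trans hq _; rewrite ler_wpM2r.
  (* The exponent is (5/4) rho eps + rho delta + eps / 4 <= 10/64 + 1/64 + 4/64; the remaining 1/64
     up to 1/4 pays for c. *)
  rewrite -powRrM mulrA -PD ler_wpM2r // ler_powR //.
  by move: re e4 rd; rewrite mulrDl mulrDl; lra.
have c64 : c^-1 <= M `^ 64^-1.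
  by apply: le_powR_of_root; rewrite ?invr_ge0 ?(ltW c0) // -/M3; lra.
rewrite powRN -(ler_pM2l (powR_gt0 4^-1 Mp)) mulfV ?gt_eqF ?powR_gt0 //.
have -> : 4^-1 = 64^-1 + 15 / 64 :> R by lra.
rewrite PD -mulrA -[leLHS](mulVf (lt0r_neq0 c0)).
by apply: ler_pM; rewrite ?invr_ge0 ?(ltW c0) //.
Qed.
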